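(* In any whole plane Spectre tiling, every blue hex cluster is necessarily a $\mathrm T1$, a $\mathrm T2$ or a $\mathrm T3$.
   Context: The Spectre is the closed polygon with successive vertices $P_0=(0,0),P_1,\dots,P_{13}$ obtained by 14 unit steps starting at $P_0$ in the directions (in degrees) $0,60,330,270,0,300,210,150,240,180,180,120,30,90$ (so the angle at $P_{10}$ is flat and the last step returns to $P_0$). A whole plane Spectre tiling is a covering of the plane by images of the Spectre under orientation-preserving isometries (no reflections), with pairwise disjoint interiors. In such a tiling any two tiles differ in orientation by a multiple of $30^\circ$; they have the same parity if they differ by a multiple of $60^\circ$. One of the parity classes, chosen arbitrarily, is called even, the other odd. Let $p=\left(\tfrac{3-\sqrt3}{2},-\tfrac{1+\sqrt3}{2}\right)$, a point inside the Spectre. The hex of the tile is the regular hexagon with vertices $P_1,P_3,P_5,P_7,P_9,p$; this is transported to every tile of the tiling. The blue hexes are the hexes of the even tiles (they are all translates of each other). Two blue hexes are adjacent if they share an edge. A (blue hex) cluster is an equivalence class of blue hexes for the equivalence relation generated by adjacency. A $\mathrm Tn$, for $n=1,2,3$, is a set of $n(n+1)/2$ hexagons (thus $1$, $3$ or $6$) of a regular hexagonal tessellation arranged in an equilateral triangle with $n$ hexagons along each side. *)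

(* Defs.v *)
(* Stdlib reals with Coquelicot; the Euclidean plane is the complex plane C. *)
From Stdlib Require Import Reals List Relations.
From Coquelicot Require Import Coquelicot.
Import ListNotations.

Open Scope R_scope.

Definition plane_set : Type := C -> Prop.

Definition same_set (A B : plane_set) : Prop := forall z, A z <-> B z.

(* Coquelicot's topology on C = R * R is the usual one of the plane. *)
Definition interior (A : plane_set) : plane_set := fun z => locally z A.

(* Unit vector in the direction of d degrees. *)
Definition cis (d : R) : C := (cos (d * PI / 180), sin (d * PI / 180)).

(* Cyclically consecutive pairs: the last vertex is joined to the first. *)
Definition edges (l : list C) : list (C * C) :=
  combine l (tl l ++ firstn 1 l).

Definition on_segment (z : C) (e : C * C) : Prop :=
  exists t : R, 0 <= t <= 1 /\
    z = Cplus (fst e) (Cmult (RtoC t) (Cminus (snd e) (fst e))).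

Definition leb (x y : R) : bool := if Rle_dec x y then true else false.
Definition ltb (x y : R) : bool := if Rlt_dec x y then true else false.

(* Whether the edge meets the open horizontal ray from z to the right. The lower
   endpoint of the edge is counted and the upper one is not, so that a ray
   through a vertex is counted correctly and horizontal edges never count. *)
Definition crosses (z : C) (e : C * C) : bool :=
  let (a, b) := e in
  xorb (leb (Im a) (Im z)) (leb (Im b) (Im z)) &&
  ltb (Re z) (Re a + (Im z - Im a) / (Im b - Im a) * (Re b - Re a)).

(* The closed region bounded by a closed polygonal line: the line itself and the
   points enclosed by it according to the even-odd rule. *)
Definition polygon (l : list C) : plane_set := fun z =>
  (exists e, In e (edges l) /\ on_segment z e) \/
  fold_right xorb false (map (crosses z) (edges l)) = true.

Definition steps : list R :=
  [0; 60; 330; 270; 0; 300; 210; 150; 240; 180; 180; 120; 30; 90].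

Definition P (k : nat) : C :=
  fold_right Cplus (RtoC 0) (map cis (firstn k steps)).

Definition p : C := ((3 - sqrt 3) / 2, - ((1 + sqrt 3) / 2)).

(* The pair (u, c) stands for the map z |-> u z + c. *)
Definition motion : Type := (C * C)%type.

Definition orientation_preserving_isometry (g : motion) : Prop :=
  Cmod (fst g) = 1.

Definition act (g : motion) (z : C) : C := Cplus (Cmult (fst g) z) (snd g).

Definition tile (g : motion) : plane_set :=
  polygon (map (fun k => act g (P k)) (seq 0 14)).

(* A tiling is given by the set of motions placing its tiles; the Spectre has no
   nontrivial symmetry, so a tile determines its motion. *)
Definition spectre_tiling (T : motion -> Prop) : Prop :=
  (forall g, T g -> orientation_preserving_isometry g) /\
  (forall z, exists g, T g /\ tile g z) /\
  (forall g h, T g -> T h -> g <> h ->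
     forall z, ~ (interior (tile g) z /\ interior (tile h) z)).

Definition same_parity (g h : motion) : Prop :=
  exists k : Z, fst h = Cmult (cis (60 * IZR k)) (fst g).

(* The even class is the parity class of the chosen tile g0. *)
Definition even_tile (T : motion -> Prop) (g0 g : motion) : Prop :=
  T g /\ same_parity g0 g.

Definition hex_vertices (g : motion) : list C :=
  map (act g) [P 1; P 3; P 5; P 7; P 9; p].

Definition hex (g : motion) : plane_set := polygon (hex_vertices g).

Definition share_edge (g h : motion) : Prop :=
  exists a b : C, In (a, b) (edges (hex_vertices g)) /\
    (In (a, b) (edges (hex_vertices h)) \/ In (b, a) (edges (hex_vertices h))).

(* Adjacency of the blue hexes of g and h. Allowing g = h is harmless, as only
   the equivalence relation generated by adjacency is used. *)
Definition adjacent (T : motion -> Prop) (g0 g h : motion) : Prop :=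
  even_tile T g0 g /\ even_tile T g0 h /\ share_edge g h.

Definition blue_cluster (T : motion -> Prop) (g0 : motion)
    (K : plane_set -> Prop) : Prop :=
  exists g, even_tile T g0 g /\
    forall H, K H <->
      exists h, clos_refl_sym_trans motion (adjacent T g0) g h /\
        same_set H (hex h).

(* The regular hexagon with centre c having c + r as a vertex. *)
Definition regular_hexagon (c r : C) : plane_set :=
  polygon (map (fun k => Cplus c (Cmult r (cis (60 * INR k)))) (seq 0 6)).

(* In the tessellation containing regular_hexagon c r, the translation carrying
   this hexagon to its neighbour across the edge from c + r to c + r * cis 60 is
   r * (1 + cis 60); rotating it by 60 degrees gives the next neighbour. *)
Definition tessellation_hexagon (c r : C) (i j : nat) : plane_set :=
  regular_hexagon
    (Cplus c (Cmult (Cmult r (Cplus (RtoC 1) (cis 60)))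
                    (Cplus (RtoC (INR i)) (Cmult (RtoC (INR j)) (cis 60)))))
    r.

(* The n (n + 1) / 2 hexagons with i + j < n form a triangle; every position and
   orientation of the triangle is obtained by varying c and r. *)
Definition is_T (n : nat) (K : plane_set -> Prop) : Prop :=
  exists c r : C, r <> RtoC 0 /\
    forall H, K H <->
      exists i j : nat, (i + j < n)%nat /\
        same_set H (tessellation_hexagon c r i j).

(* Main.v *)
(* Cut the Spectre into triangles. Near a point z, a tile is a union of cones, and only
   finitely many tiles come near z, so just outside an edge of a tile that starts at z
   there is a tile with an edge along the same ray. At the corners P_3 and P_7, whose
   angle is 120 degrees, the latter tile must have a vertex at the corner, since
   otherwise it leaves an angle of 60 degrees, while all angles are at least 90 degrees.
   So the tiles across the edges 2, 3, 6 and 7 are glued vertex to vertex, and all that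
   matters takes place in the lattice Z[zeta], where zeta is a 12th root of unity. There
   are 46 ways to place these four tiles without overlaps. They decide which of the 8
   possible neighbours of a blue hex are present, which leaves 25 cases; completing a
   hex to a cluster in all ways that are consistent with these cases yields triangles
   only. *)
Require Import Defs.
From Stdlib Require Import Reals List Relations Lra Lia Psatz ZArith Bool Btauto Classical.
From Coquelicot Require Import Coquelicot.
Import Defs ListNotations.

Open Scope R_scope.

(** * Triangles and the even-odd rule *)

(** The motions of a tiling are arbitrary: contact edge to edge and angles in multiples of 30
    degrees have to be derived, and this is done for as few edges as possible. Contact along an edge
    concerns points just beside a ray, which a direction alone does not distinguish from points on
    the ray. Therefore curves z + s u + s^2 v are used; on them every orientation is a quadratic
    polynomial in s, whose sign for small s is lexicographic in its coefficients. Once two tiles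
    share two vertices, their relative motion has coordinates in Z[zeta], and signs of p + q sqrt 3
    are decided on integers. Overlap tests are used in one direction only: an overlap that is found
    excludes a placement, while one that is missed merely leaves a spurious case for the final
    check. To close a cluster, the absence of neighbours must be known as well; it follows from the
    presence of other tiles, since a possible neighbour that is not chosen overlaps whatever is
    glued to its edge. *)

Definition orient (a b z : C) : R :=
  (Re b - Re a) * (Im z - Im a) - (Im b - Im a) * (Re z - Re a).

Definition open_triangle (a b c z : C) : Prop :=
  0 < orient a b z /\ 0 < orient b c z /\ 0 < orient c a z.

Definition closed_triangle (a b c z : C) : Prop :=
  0 <= orient a b z /\ 0 <= orient b c z /\ 0 <= orient c a z.

Lemma orient_sum (a b c z : C) :
  orient a b c = orient b c z + orient c a z + orient a b z.
Proof. unfold orient; ring. Qed.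

Lemma orient_swap (a b z : C) : orient b a z = - orient a b z.
Proof. unfold orient; ring. Qed.

Lemma orient_rot (a b z : C) : orient b z a = orient a b z.
Proof. unfold orient; ring. Qed.

(* The weights are the barycentric coordinates of z up to the factor [orient a b c]. *)
Lemma orient_height (a b c z : C) :
  orient b c z * (Im a - Im z) + orient c a z * (Im b - Im z)
  + orient a b z * (Im c - Im z) = 0.
Proof. unfold orient; ring. Qed.

Lemma orient_affine (a b c d e z : C) :
  orient a b c * orient d e z =
  orient b c z * orient d e a + orient c a z * orient d e b
  + orient a b z * orient d e c.
Proof. unfold orient; ring. Qed.

Lemma ltb_ext (x y x' y' : R) : (x < y <-> x' < y') -> ltb x y = ltb x' y'.
Proof.
  intros H; unfold ltb.
  destruct (Rlt_dec x y), (Rlt_dec x' y'); tauto.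
Qed.

Lemma leb_true (x y : R) : x <= y -> leb x y = true.
Proof. intros; unfold leb; destruct (Rle_dec x y); easy. Qed.

Lemma leb_false (x y : R) : y < x -> leb x y = false.
Proof. intros; unfold leb; destruct (Rle_dec x y); [lra | easy]. Qed.

(** Multiplying by the positive height [Im b - Im a] turns the comparison of abscissae into the sign
    of a determinant. Descending edges are reduced to this case by [crosses_sym]. *)
Lemma crosses_up (z a b : C) :
  Im a <= Im z -> Im z < Im b -> crosses z (a, b) = ltb 0 (orient a b z).
Proof.
  intros Ha Hb; unfold crosses.
  rewrite (leb_true _ _ Ha), (leb_false _ _ Hb); simpl.
  apply ltb_ext; unfold orient.
  assert (Hh : 0 < Im b - Im a) by lra.
  replace (Re a + (Im z - Im a) / (Im b - Im a) * (Re b - Re a)) with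
    (Re z + ((Re b - Re a) * (Im z - Im a) - (Im b - Im a) * (Re z - Re a))
            / (Im b - Im a)) by (field; lra).
  set (N := _ - _); split; intros H.
  - apply Rnot_le_lt; intros HN.
    assert (N / (Im b - Im a) <= 0); [|lra].
    apply Rmult_le_reg_r with (Im b - Im a); [easy|].
    unfold Rdiv; rewrite Rmult_assoc, Rinv_l; lra.
  - assert (0 < N / (Im b - Im a)) by (apply Rdiv_lt_0_compat; lra); lra.
Qed.

Lemma crosses_sym (z a b : C) : crosses z (a, b) = crosses z (b, a).
Proof.
  unfold crosses.
  destruct (Rle_dec (Im a) (Im z)) as [Ha|Ha], (Rle_dec (Im b) (Im z)) as [Hb|Hb];
    repeat rewrite ?(leb_true _ _ Ha), ?(leb_true _ _ Hb);
    try rewrite (leb_false (Im a) (Im z)) by lra;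
    try rewrite (leb_false (Im b) (Im z)) by lra; simpl; try easy;
    f_equal; field; lra.
Qed.

Lemma crosses_low (z a b : C) :
  Im a <= Im z -> Im b <= Im z -> crosses z (a, b) = false.
Proof.
  intros Ha Hb; unfold crosses.
  now rewrite (leb_true _ _ Ha), (leb_true _ _ Hb).
Qed.

Lemma crosses_high (z a b : C) :
  Im z < Im a -> Im z < Im b -> crosses z (a, b) = false.
Proof.
  intros Ha Hb; unfold crosses.
  now rewrite (leb_false _ _ Ha), (leb_false _ _ Hb).
Qed.

Definition parity3 (z a b c : C) : bool :=
  xorb (crosses z (a, b)) (xorb (crosses z (b, c)) (crosses z (c, a))).

Lemma parity3_rot (z a b c : C) : parity3 z b c a = parity3 z a b c.
Proof. unfold parity3; btauto. Qed.

(** Boundary points are left undecided on purpose: the half-open counting rule puts some of them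
    inside and others outside. *)
Definition parity3_spec (a b c z : C) : Prop :=
  (open_triangle a b c z -> parity3 z a b c = true) /\
  (parity3 z a b c = true -> closed_triangle a b c z).

Lemma parity3_spec_rot (a b c z : C) : parity3_spec b c a z -> parity3_spec a b c z.
Proof.
  unfold parity3_spec, open_triangle, closed_triangle.
  rewrite parity3_rot; tauto.
Qed.

(** By [orient_height] the heights of the corners over z, weighted by the three orientations, sum to
    zero; so two of the orientations and the signs of the heights determine the sign of the
    third. *)
Lemma parity3_one_low (a b c z : C) :
  0 < orient a b c -> Im a <= Im z -> Im z < Im b -> Im z < Im c ->
  parity3_spec a b c z.
Proof.
  intros HD Ha Hb Hc.
  pose proof (orient_sum a b c z) as HS; pose proof (orient_height a b c z) as HH.
  unfold parity3_spec, parity3, open_triangle, closed_triangle.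
  rewrite (crosses_up z a b Ha Hb), (crosses_high z b c Hb Hc), (crosses_sym z c a),
    (crosses_up z a c Ha Hc), (orient_swap c a z).
  set (u := orient b c z) in *; set (v := orient c a z) in *;
    set (w := orient a b z) in *.
  unfold ltb.
  destruct (Rlt_dec 0 w), (Rlt_dec 0 (- v)); simpl; split; intros H; try easy; try lra.
  - repeat split; [lra| |lra].
    apply Rnot_lt_le; intros Hu; nra.
  - exfalso; nra.
Qed.

Lemma parity3_two_low (a b c z : C) :
  0 < orient a b c -> Im a <= Im z -> Im b <= Im z -> Im z < Im c ->
  parity3_spec a b c z.
Proof.
  intros HD Ha Hb Hc.
  pose proof (orient_sum a b c z) as HS; pose proof (orient_height a b c z) as HH.
  unfold parity3_spec, parity3, open_triangle, closed_triangle.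
  rewrite (crosses_low z a b Ha Hb), (crosses_up z b c Hb Hc), (crosses_sym z c a),
    (crosses_up z a c Ha Hc), (orient_swap c a z).
  set (u := orient b c z) in *; set (v := orient c a z) in *;
    set (w := orient a b z) in *.
  unfold ltb.
  destruct (Rlt_dec 0 u), (Rlt_dec 0 (- v)); simpl; split; intros H; try easy; try lra.
  - repeat split; [|lra|lra].
    apply Rnot_lt_le; intros Hu; nra.
  - exfalso; nra.
Qed.

(** Up to rotation one or two corners are low. If all corners are on one side of the horizontal line
    through z, nothing crosses, and three positive weights cannot balance the heights unless the
    triangle is degenerate. *)
Lemma parity3_correct (a b c z : C) : 0 < orient a b c -> parity3_spec a b c z.
Proof.
  intros HD.
  assert (HD1 : 0 < orient b c a) by now rewrite orient_rot.
  assert (HD2 : 0 < orient c a b) by now rewrite orient_rot.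
  pose proof (orient_height a b c z) as HH.
  destruct (Rle_lt_dec (Im a) (Im z)), (Rle_lt_dec (Im b) (Im z)),
    (Rle_lt_dec (Im c) (Im z)).
  - unfold parity3_spec, parity3; rewrite !crosses_low by easy; split; [|easy].
    intros (H1 & H2 & H3); exfalso.
    assert (Im a = Im z) by nra; assert (Im b = Im z) by nra;
      assert (Im c = Im z) by nra.
    unfold orient in HD; nra.
  - now apply parity3_two_low.
  - apply parity3_spec_rot, parity3_spec_rot; now apply parity3_two_low.
  - now apply parity3_one_low.
  - apply parity3_spec_rot; now apply parity3_two_low.
  - apply parity3_spec_rot; now apply parity3_one_low.
  - apply parity3_spec_rot, parity3_spec_rot; now apply parity3_one_low.
  - unfold parity3_spec, parity3; rewrite !crosses_high by easy; split; [|easy].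
    intros (H1 & H2 & H3); exfalso; nra.
Qed.

Lemma on_segment_sym (z a b : C) : on_segment z (a, b) -> on_segment z (b, a).
Proof.
  intros (t & Ht & ->); exists (1 - t); split; [lra|].
  destruct a, b; apply injective_projections; simpl; ring.
Qed.

Lemma on_segment_closed (a b c z : C) :
  0 < orient a b c -> on_segment z (a, b) -> closed_triangle a b c z.
Proof.
  intros HD (t & Ht & ->).
  destruct a as [a1 a2], b as [b1 b2], c as [c1 c2].
  unfold closed_triangle, orient in *; simpl in *.
  repeat split; nra.
Qed.

(** * The lattice Z[zeta] *)

Definition zeta : C := (sqrt 3 / 2, 1 / 2).

Lemma sqrt3_sq : sqrt 3 * sqrt 3 = 3.
Proof. apply sqrt_sqrt; lra. Qed.

Lemma sqrt3_pos : 0 < sqrt 3.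
Proof. apply sqrt_lt_R0; lra. Qed.

Ltac C_ext := apply injective_projections; simpl.
Ltac sqrt3_field :=
  pose proof sqrt3_sq as sqrt3_sq; set (s := sqrt 3) in *; clearbody s; try (field [sqrt3_sq]); try nra.

Lemma cis_add (x y : R) : cis (x + y) = Cmult (cis x) (cis y).
Proof.
  unfold cis; replace ((x + y) * PI / 180) with (x * PI / 180 + y * PI / 180) by field.
  C_ext; [apply cos_plus | rewrite sin_plus; ring].
Qed.

Lemma cis_0 : cis 0 = 1.
Proof.
  unfold cis; replace (0 * PI / 180) with 0 by field.
  rewrite cos_0, sin_0; reflexivity.
Qed.

Lemma cis_30 : cis 30 = zeta.
Proof.
  unfold cis, zeta; replace (30 * PI / 180) with (PI / 6) by field.
  rewrite cos_PI6, sin_PI6; reflexivity.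
Qed.

Lemma cis_zeta (n : nat) : cis (30 * INR n) = Cpow zeta n.
Proof.
  induction n as [|n IH].
  - simpl; rewrite Rmult_0_r; apply cis_0.
  - rewrite Cpow_S, <- IH, <- cis_30, <- cis_add, S_INR; f_equal; ring.
Qed.

Lemma zeta_2 : Cpow zeta 2 = (1 / 2, sqrt 3 / 2).
Proof. unfold zeta; C_ext; sqrt3_field. Qed.

Lemma zeta_3 : Cpow zeta 3 = (0, 1).
Proof. rewrite Cpow_S, zeta_2; unfold zeta; C_ext; sqrt3_field. Qed.

Lemma zeta_6 : Cpow zeta 6 = (-1, 0).
Proof. change 6%nat with (3 + 3)%nat; rewrite Cpow_add_r, zeta_3; C_ext; ring. Qed.

Lemma zeta_12 : Cpow zeta 12 = 1.
Proof. change 12%nat with (6 + 6)%nat; rewrite Cpow_add_r, zeta_6; C_ext; ring. Qed.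

Lemma zeta_mod (n : nat) : Cpow zeta (n mod 12) = Cpow zeta n.
Proof.
  rewrite (Nat.div_mod_eq n 12) at 2.
  now rewrite Cpow_add_r, Cpow_mult_r, zeta_12, Cpow_1_l, Cmult_1_l.
Qed.

Lemma zeta_nonzero (n : nat) : Cpow zeta n <> 0.
Proof.
  apply Cpow_nz; unfold zeta; intros H; injection H; lra.
Qed.

(* [Lat a b c d] stands for a + b zeta + c zeta^2 + d zeta^3 in Z[zeta]. *)
Record lat := Lat { l0 : Z; l1 : Z; l2 : Z; l3 : Z }.

Definition lval (x : lat) : C :=
  (IZR (l0 x) + IZR (l2 x) / 2 + IZR (l1 x) * (sqrt 3 / 2),
   IZR (l3 x) + IZR (l1 x) / 2 + IZR (l2 x) * (sqrt 3 / 2)).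

Definition lzero : lat := Lat 0 0 0 0.
Definition lone : lat := Lat 1 0 0 0.
Definition ladd (x y : lat) : lat :=
  Lat (l0 x + l0 y) (l1 x + l1 y) (l2 x + l2 y) (l3 x + l3 y).
Definition lopp (x : lat) : lat := Lat (- l0 x) (- l1 x) (- l2 x) (- l3 x).
Definition lsub (x y : lat) : lat := ladd x (lopp y).
Definition lscale (n : Z) (x : lat) : lat :=
  Lat (n * l0 x) (n * l1 x) (n * l2 x) (n * l3 x).
(* zeta^4 = zeta^2 - 1 *)
Definition lzeta (x : lat) : lat := Lat (- l3 x) (l0 x) (l1 x + l3 x) (l2 x).
Definition lrot (n : nat) (x : lat) : lat := Nat.iter n lzeta x.
Definition leqb (x y : lat) : bool :=
  (l0 x =? l0 y)%Z && (l1 x =? l1 y)%Z && (l2 x =? l2 y)%Z && (l3 x =? l3 y)%Z.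

Lemma leqb_eq (x y : lat) : leqb x y = true -> x = y.
Proof.
  unfold leqb; rewrite !andb_true_iff, !Z.eqb_eq.
  destruct x, y; simpl; intros [[[-> ->] ->] ->]; reflexivity.
Qed.

Lemma lval_zero : lval lzero = 0.
Proof. C_ext; lra. Qed.

Lemma lval_one : lval lone = 1.
Proof. C_ext; lra. Qed.

Lemma lval_add (x y : lat) : lval (ladd x y) = Cplus (lval x) (lval y).
Proof. C_ext; rewrite !plus_IZR; lra. Qed.

Lemma lval_opp (x : lat) : lval (lopp x) = Copp (lval x).
Proof. C_ext; rewrite !opp_IZR; lra. Qed.

Lemma lval_sub (x y : lat) : lval (lsub x y) = Cminus (lval x) (lval y).
Proof. unfold lsub; rewrite lval_add, lval_opp; reflexivity. Qed.

Lemma lval_scale (n : Z) (x : lat) : lval (lscale n x) = Cmult (RtoC (IZR n)) (lval x).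
Proof. C_ext; rewrite !mult_IZR; lra. Qed.

Lemma lval_zeta (x : lat) : lval (lzeta x) = Cmult zeta (lval x).
Proof. C_ext; rewrite ?opp_IZR, ?plus_IZR; sqrt3_field. Qed.

Lemma lval_rot (n : nat) (x : lat) : lval (lrot n x) = Cmult (Cpow zeta n) (lval x).
Proof.
  induction n as [|n IH]; [simpl; ring|].
  rewrite Cpow_S; unfold lrot in *; simpl; rewrite lval_zeta, IH; ring.
Qed.

(* [(p, q)] stands for p + q sqrt 3. *)
Definition sval (x : Z * Z) : R := IZR (fst x) + IZR (snd x) * sqrt 3.
(** Opposite signs of p and q are settled by comparing p^2 with 3 q^2. Only soundness is proved
    below; a failed test is never read as information about the sign. *)
Definition spos (x : Z * Z) : bool :=
  let (p, q) := x in
  if (0 <=? q)%Z then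
    if (0 <=? p)%Z then (0 <? p)%Z || (0 <? q)%Z else (p * p <? 3 * (q * q))%Z
  else (0 <? p)%Z && (3 * (q * q) <? p * p)%Z.
Definition sneg (x : Z * Z) : bool := spos (- fst x, - snd x)%Z.
Definition szero (x : Z * Z) : bool := (fst x =? 0)%Z && (snd x =? 0)%Z.

Lemma spos_pos (x : Z * Z) : spos x = true -> 0 < sval x.
Proof.
  destruct x as [p q]; unfold spos, sval; cbn [fst snd].
  pose proof sqrt3_sq as H3; pose proof sqrt3_pos.
  assert (Hs : IZR q * sqrt 3 * (IZR q * sqrt 3) = 3 * (IZR q * IZR q))
    by (generalize (sqrt 3) H3; intros s Hs; replace 3 with (s * s); ring).
  destruct (Z.leb_spec 0 q) as [Hq|Hq]; [destruct (Z.leb_spec 0 p) as [Hp|Hp]|].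
  - rewrite orb_true_iff, !Z.ltb_lt.
    apply IZR_le in Hq, Hp.
    intros [H1|H1]; apply IZR_lt in H1.
    + assert (0 <= IZR q * sqrt 3) by (apply Rmult_le_pos; lra); lra.
    + assert (0 < IZR q * sqrt 3) by (apply Rmult_lt_0_compat; lra); lra.
  - rewrite Z.ltb_lt; intros H1; apply IZR_lt in H1, Hp; apply IZR_le in Hq.
    rewrite !mult_IZR in H1.
    assert (0 <= IZR q * sqrt 3) by (apply Rmult_le_pos; lra).
    assert (- IZR p < IZR q * sqrt 3); [|lra].
    apply Rsqr_incrst_0; [unfold Rsqr; rewrite Hs; lra | lra | lra].
  - rewrite andb_true_iff, !Z.ltb_lt; intros [H1 H2].
    apply IZR_lt in H1, H2, Hq; rewrite !mult_IZR in H2.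
    assert (0 < - IZR q * sqrt 3) by (apply Rmult_lt_0_compat; lra).
    assert (- IZR q * sqrt 3 < IZR p); [|lra].
    apply Rsqr_incrst_0; [|lra|lra].
    unfold Rsqr; lra.
Qed.

Lemma sneg_neg (x : Z * Z) : sneg x = true -> sval x < 0.
Proof.
  unfold sneg; intros H; apply spos_pos in H; unfold sval in *; cbn [fst snd] in *.
  rewrite !opp_IZR in H; lra.
Qed.

Lemma szero_zero (x : Z * Z) : szero x = true -> sval x = 0.
Proof.
  unfold szero, sval; rewrite andb_true_iff, !Z.eqb_eq; intros [-> ->]; ring.
Qed.

(** * Orientations in lattice coordinates *)

Definition cross (u v : C) : R := Re u * Im v - Im u * Re v.

Lemma orient_cross (a b z : C) : orient a b z = cross (Cminus b a) (Cminus z a).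
Proof. destruct a, b, z; unfold orient, cross, Re, Im; simpl; ring. Qed.

(** The doubled coordinates of x are r + [l1 x] sqrt 3 and i + [l2 x] sqrt 3; doubling removes all
    halves and accounts for the factor 4 in [lcross_val]. *)
Definition lcross (x y : lat) : Z * Z :=
  let r := (2 * l0 x + l2 x)%Z in let i := (2 * l3 x + l1 x)%Z in
  let r' := (2 * l0 y + l2 y)%Z in let i' := (2 * l3 y + l1 y)%Z in
  (r * i' - i * r' + 3 * (l1 x * l2 y - l2 x * l1 y),
   r * l2 y - l2 x * r' + l1 x * i' - i * l1 y)%Z.

Lemma lcross_val (x y : lat) : sval (lcross x y) = 4 * cross (lval x) (lval y).
Proof.
  unfold sval, lcross, cross, lval, Re, Im; cbn [fst snd].
  repeat rewrite ?plus_IZR, ?minus_IZR, ?mult_IZR.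
  pose proof sqrt3_sq as H; set (s := sqrt 3) in *; clearbody s; field [H].
Qed.

Definition lorient (a b z : lat) : Z * Z := lcross (lsub b a) (lsub z a).

Lemma lorient_val (a b z : lat) :
  sval (lorient a b z) = 4 * orient (lval a) (lval b) (lval z).
Proof. unfold lorient; now rewrite lcross_val, !lval_sub, orient_cross. Qed.

Definition dirs : list nat := [0; 2; 11; 9; 0; 10; 7; 5; 8; 6; 6; 4; 1; 3]%nat.

Definition vertices : list lat :=
  Eval vm_compute in
  map (fun k => fold_right ladd lzero (map (fun n => lrot n lone) (firstn k dirs)))
    (seq 0 14).

Definition vertex (k : nat) : lat := nth k vertices lzero.

Lemma steps_dirs : steps = map (fun n => 30 * INR n) dirs.
Proof. unfold steps, dirs; cbn [map]; repeat f_equal; simpl; ring. Qed.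

Lemma vertex_val (k : nat) : (k < 14)%nat -> lval (vertex k) = P k.
Proof.
  intros Hk; unfold P.
  transitivity (lval (fold_right ladd lzero
    (map (fun n => lrot n lone) (firstn k dirs)))).
  - f_equal; do 14 (destruct k; [reflexivity|]); lia.
  - rewrite steps_dirs, firstn_map, map_map; clear Hk.
    induction (firstn k dirs) as [|n l IH]; cbn [map fold_right].
    + apply lval_zero.
    + rewrite lval_add, lval_rot, lval_one, IH, cis_zeta, Cmult_1_r; reflexivity.
Qed.

(** * A triangulation of the Spectre *)

Definition isometry (g : motion) : Prop := Cmod (fst g) = 1.

Lemma isometry_sq (g : motion) :
  isometry g -> Re (fst g) * Re (fst g) + Im (fst g) * Im (fst g) = 1.
Proof.
  unfold isometry, Cmod; intros H.
  assert (H2 : sqrt (fst (fst g) ^ 2 + snd (fst g) ^ 2) *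
    sqrt (fst (fst g) ^ 2 + snd (fst g) ^ 2) = 1) by (rewrite H; ring).
  rewrite sqrt_sqrt in H2 by nra; unfold Re, Im; lra.
Qed.

Lemma cross_isometry (g : motion) (u v : C) :
  isometry g -> cross (Cmult (fst g) u) (Cmult (fst g) v) = cross u v.
Proof.
  intros Hg; apply isometry_sq in Hg.
  destruct g as [[a b] c], u as [u1 u2], v as [v1 v2].
  unfold cross, Re, Im in *; simpl in *.
  transitivity ((a * a + b * b) * (u1 * v2 - u2 * v1)); [ring | rewrite Hg; ring].
Qed.

Lemma act_minus (g : motion) (a b : C) :
  Cminus (act g a) (act g b) = Cmult (fst g) (Cminus a b).
Proof. unfold act; ring. Qed.

Lemma orient_act (g : motion) (a b c : C) :
  isometry g -> orient (act g a) (act g b) (act g c) = orient a b c.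
Proof. intros Hg; now rewrite !orient_cross, !act_minus, cross_isometry. Qed.

Definition pt (g : motion) (k : nat) : C := act g (lval (vertex k)).

Definition lo (a b c : nat) : Z * Z := lorient (vertex a) (vertex b) (vertex c).

(** Orientations are invariant under motions, so every sign concerning the vertices of a single tile
    is computed once, in the reference tile. *)
Lemma lo_val (g : motion) (a b c : nat) :
  isometry g -> sval (lo a b c) = 4 * orient (pt g a) (pt g b) (pt g c).
Proof. intros Hg; unfold lo, pt; now rewrite lorient_val, orient_act. Qed.

Definition triangle : Type := (nat * nat * nat)%type.

(** The triangles are counterclockwise, while the boundary of the Spectre runs clockwise; so edge k
    occurs as the side ([next k], k), and every diagonal occurs once in each direction. *)
Definition triangles : list triangle :=
  [(12, 11, 10); (13, 12, 10); (13, 10, 9); (8, 7, 6); (8, 6, 5); (0, 13, 9);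
   (4, 3, 2); (8, 5, 4); (8, 4, 2); (8, 2, 1); (8, 1, 0); (9, 8, 0)]%nat.

Definition sides (t : triangle) : list (nat * nat) :=
  let '(i, j, k) := t in [(i, j); (j, k); (k, i)].
Definition corners (t : triangle) : list nat := let '(i, j, k) := t in [i; j; k].

Definition in_open (g : motion) (t : triangle) (z : C) : Prop :=
  forall a b, In (a, b) (sides t) -> 0 < orient (pt g a) (pt g b) z.
Definition in_closed (g : motion) (t : triangle) (z : C) : Prop :=
  forall a b, In (a, b) (sides t) -> 0 <= orient (pt g a) (pt g b) z.

Lemma in_open_triangle (g : motion) (i j k : nat) (z : C) :
  in_open g (i, j, k) z <-> open_triangle (pt g i) (pt g j) (pt g k) z.
Proof.
  unfold in_open, open_triangle; simpl; split.
  - intros H; repeat split; apply H; tauto.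
  - intros (H1 & H2 & H3) a b [H|[H|[H|[]]]]; injection H as <- <-; easy.
Qed.

Lemma in_closed_triangle (g : motion) (i j k : nat) (z : C) :
  in_closed g (i, j, k) z <-> closed_triangle (pt g i) (pt g j) (pt g k) z.
Proof.
  unfold in_closed, closed_triangle; simpl; split.
  - intros H; repeat split; apply H; tauto.
  - intros (H1 & H2 & H3) a b [H|[H|[H|[]]]]; injection H as <- <-; easy.
Qed.

Lemma triangles_ccw (g : motion) (i j k : nat) :
  isometry g -> In (i, j, k) triangles -> 0 < orient (pt g i) (pt g j) (pt g k).
Proof.
  intros Hg Ht.
  assert (H : forallb (fun t => let '(i, j, k) := t in spos (lo i j k)) triangles = true)
    by (vm_compute; reflexivity).
  rewrite forallb_forall in H; specialize (H _ Ht); cbv beta iota in H.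
  apply spos_pos in H; rewrite (lo_val g) in H by easy; lra.
Qed.

Definition snonpos (x : Z * Z) : bool := sneg x || szero x.

Lemma snonpos_le (x : Z * Z) : snonpos x = true -> sval x <= 0.
Proof.
  unfold snonpos; rewrite orb_true_iff; intros [H|H].
  - apply sneg_neg in H; lra.
  - apply szero_zero in H; lra.
Qed.

(** Separating-line test for an open triangle t and a closed triangle t'. If the line is a side of
    t', one corner of t must lie strictly beyond it, so that the open triangle avoids the line. *)
Definition separated (t t' : triangle) : bool :=
  existsb (fun s : nat * nat => let (a, b) := s in
    forallb (fun c => snonpos (lo a b c)) (corners t')) (sides t) ||
  existsb (fun s : nat * nat => let (a, b) := s in
    forallb (fun c => snonpos (lo a b c)) (corners t) &&
    existsb (fun c => sneg (lo a b c)) (corners t)) (sides t').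

Lemma separated_disjoint (g : motion) (t t' : triangle) (z : C) :
  isometry g -> In t triangles -> In t' triangles ->
  separated t t' = true -> in_open g t z -> in_closed g t' z -> False.
Proof.
  destruct t as [[i j] k], t' as [[i' j'] k'].
  intros Hg Ht Ht' H Ho Hc.
  pose proof (triangles_ccw g _ _ _ Hg Ht) as HD.
  pose proof (triangles_ccw g _ _ _ Hg Ht') as HD'.
  pose proof (proj1 (in_open_triangle _ _ _ _ _) Ho) as (O1 & O2 & O3).
  pose proof (proj1 (in_closed_triangle _ _ _ _ _) Hc) as (C1 & C2 & C3).
  unfold separated in H; rewrite orb_true_iff, !existsb_exists in H.
  destruct H as [([a b] & Hs & H)|([a b] & Hs & H)].
  - specialize (Ho _ _ Hs); clear Hs Hc.
    cbn [corners forallb] in H; rewrite !andb_true_iff in H.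
    destruct H as (H1 & H2 & H3 & _).
    apply snonpos_le in H1, H2, H3; rewrite (lo_val g) in H1, H2, H3 by easy.
    pose proof (orient_affine (pt g i') (pt g j') (pt g k') (pt g a) (pt g b) z).
    nra.
  - specialize (Hc _ _ Hs); clear Hs Ho.
    cbn [corners forallb existsb] in H; rewrite !andb_true_iff, !orb_true_iff in H.
    destruct H as ((H1 & H2 & H3 & _) & Hn).
    apply snonpos_le in H1, H2, H3; rewrite (lo_val g) in H1, H2, H3 by easy.
    pose proof (orient_affine (pt g i) (pt g j) (pt g k) (pt g a) (pt g b) z).
    destruct Hn as [Hn|[Hn|[Hn|Hn]]]; [| | |easy];
      apply sneg_neg in Hn; rewrite (lo_val g) in Hn by easy; nra.
Qed.

Definition triangle_eqb (t t' : triangle) : bool :=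
  let '(i, j, k) := t in let '(i', j', k') := t' in
  (i =? i')%nat && (j =? j')%nat && (k =? k')%nat.

Lemma triangle_eqb_eq (t t' : triangle) : triangle_eqb t t' = true -> t = t'.
Proof.
  destruct t as [[i j] k], t' as [[i' j'] k']; unfold triangle_eqb.
  rewrite !andb_true_iff, !Nat.eqb_eq; intros [[-> ->] ->]; reflexivity.
Qed.

Lemma triangles_separated (t t' : triangle) :
  In t triangles -> In t' triangles -> t = t' \/ separated t t' = true.
Proof.
  intros Ht Ht'.
  assert (H : forallb (fun t => forallb (fun t' => triangle_eqb t t' || separated t t')
    triangles) triangles = true) by (vm_compute; reflexivity).
  rewrite forallb_forall in H; specialize (H _ Ht).
  rewrite forallb_forall in H; specialize (H _ Ht').
  rewrite orb_true_iff in H; destruct H as [H|H]; [left|now right].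
  now apply triangle_eqb_eq.
Qed.

Definition parity_triangle (V : nat -> C) (z : C) (t : triangle) : bool :=
  let '(i, j, k) := t in parity3 z (V i) (V j) (V k).

(* Each diagonal is a side of two triangles, so its contribution cancels. *)
Lemma parity_polygon (V : nat -> C) (z : C) :
  fold_right xorb false (map (crosses z) (edges (map V (seq 0 14)))) =
  fold_right xorb false (map (parity_triangle V z) triangles).
Proof.
  cbv [edges map seq tl firstn app combine fold_right triangles parity_triangle parity3].
  (* Directing every segment from the smaller to the larger index turns the two traversals of a
     diagonal into the same atom; what remains is an identity of Boolean sums. *)
  repeat match goal with
  | |- context [crosses z (V ?i, V ?j)] =>
    lazymatch eval compute in (Nat.ltb j i) with
    | true => rewrite (crosses_sym z (V i) (V j))
    end
  end.
  btauto.
Qed.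

Lemma tile_pt (g : motion) (z : C) :
  tile g z <-> polygon (map (pt g) (seq 0 14)) z.
Proof.
  unfold tile; erewrite map_ext_in; [reflexivity|].
  intros k Hk; apply in_seq in Hk; unfold pt; rewrite vertex_val; [easy|lia].
Qed.

Lemma xor_single {A : Type} (f : A -> bool) (l : list A) (x : A) :
  NoDup l -> In x l -> f x = true -> (forall y, In y l -> y <> x -> f y = false) ->
  fold_right xorb false (map f l) = true.
Proof.
  intros HN; induction HN as [|y l Hy HN IH]; [easy|]; intros [->|Hx] Hf H;
    cbn [map fold_right].
  - assert (E : fold_right xorb false (map f l) = false).
    { assert (H' : forall y, In y l -> f y = false).
      { intros y Hyl; apply H; [now right|]; now intros ->. }
      clear - H'; induction l as [|y l IH]; cbn [map fold_right]; [easy|].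
      rewrite H', IH; [easy | intros; apply H'; now right | now left]. }
    now rewrite E, Hf.
  - rewrite H; [|now left|now intros ->].
    rewrite IH; [easy|easy|easy|]; intros; apply H; [now right|easy].
Qed.

Lemma xor_exists {A : Type} (f : A -> bool) (l : list A) :
  fold_right xorb false (map f l) = true -> exists x, In x l /\ f x = true.
Proof.
  induction l as [|y l IH]; cbn [map fold_right]; [easy|].
  destruct (f y) eqn:E; [exists y; simpl; tauto|]; rewrite xorb_false_l; intros H.
  destruct (IH H) as (x & Hx & Hf); exists x; simpl; tauto.
Qed.

(** Exactly one triangle contributes to the parity sum, namely t: another one of odd parity would
    contain z in its closure, against the separation of the triangles. *)
Lemma tile_open (g : motion) (t : triangle) (z : C) :
  isometry g -> In t triangles -> in_open g t z -> tile g z.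
Proof.
  intros Hg Ht Ho; apply tile_pt; right.
  rewrite parity_polygon; apply xor_single with t; [| easy | |].
  - repeat (constructor; [simpl; intuition discriminate|]); constructor.
  - destruct t as [[i j] k]; apply parity3_correct.
    + now apply triangles_ccw.
    + now apply in_open_triangle.
  - intros t' Ht' Hne; apply not_true_iff_false; intros Hp.
    destruct (triangles_separated t t' Ht Ht') as [->|Hs]; [easy|].
    apply (separated_disjoint g t t' z); try easy.
    destruct t' as [[i j] k]; apply in_closed_triangle.
    apply parity3_correct; [now apply triangles_ccw | exact Hp].
Qed.

Definition edge_triangle (k : nat) : triangle :=
  nth k [(8, 1, 0); (8, 2, 1); (4, 3, 2); (4, 3, 2); (8, 5, 4); (8, 6, 5); (8, 7, 6);
         (8, 7, 6); (9, 8, 0); (13, 10, 9); (12, 11, 10); (12, 11, 10); (13, 12, 10);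
         (0, 13, 9)]%nat (0, 0, 0)%nat.

Definition next (k : nat) : nat := if (k =? 13)%nat then 0%nat else S k.

Lemma edge_triangle_side (k : nat) :
  (k < 14)%nat ->
  In (edge_triangle k) triangles /\ In (next k, k) (sides (edge_triangle k)).
Proof. intros Hk; do 14 (destruct k; [simpl; tauto|]); lia. Qed.

Lemma on_side_closed (g : motion) (t : triangle) (a b : nat) (z : C) :
  isometry g -> In t triangles -> In (a, b) (sides t) ->
  on_segment z (pt g a, pt g b) -> in_closed g t z.
Proof.
  destruct t as [[i j] k]; intros Hg Ht Hs Hz.
  pose proof (triangles_ccw g _ _ _ Hg Ht) as HD.
  assert (HD1 : 0 < orient (pt g j) (pt g k) (pt g i)) by now rewrite orient_rot.
  assert (HD2 : 0 < orient (pt g k) (pt g i) (pt g j)) by now rewrite orient_rot.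
  apply in_closed_triangle.
  destruct Hs as [H|[H|[H|[]]]]; injection H as <- <-;
    (eapply on_segment_closed in Hz; [|eassumption]); unfold closed_triangle in *; tauto.
Qed.

Lemma edges_pt (g : motion) (e : C * C) :
  In e (edges (map (pt g) (seq 0 14))) ->
  exists k, (k < 14)%nat /\ e = (pt g k, pt g (next k)).
Proof.
  cbv [edges map seq tl firstn app combine]; intros H.
  repeat destruct H as [<-|H];
    [exists 0%nat|exists 1%nat|exists 2%nat|exists 3%nat|exists 4%nat|exists 5%nat|
     exists 6%nat|exists 7%nat|exists 8%nat|exists 9%nat|exists 10%nat|exists 11%nat|
     exists 12%nat|exists 13%nat|easy]; split; try reflexivity; lia.
Qed.

Lemma tile_closed (g : motion) (z : C) :
  isometry g -> tile g z -> exists t, In t triangles /\ in_closed g t z.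
Proof.
  intros Hg Hz; apply tile_pt in Hz; destruct Hz as [(e & He & Hz)|Hz].
  - apply edges_pt in He; destruct He as (k & Hk & ->).
    exists (edge_triangle k); destruct (edge_triangle_side k Hk) as [H1 H2].
    split; [easy|]; apply (on_side_closed g _ _ _ z Hg H1 H2).
    now apply on_segment_sym.
  - rewrite parity_polygon in Hz; apply xor_exists in Hz.
    destruct Hz as ([[i j] k] & Ht & Hp); exists (i, j, k); split; [easy|].
    apply in_closed_triangle, parity3_correct; [now apply triangles_ccw | exact Hp].
Qed.

Lemma orient_locally (a b z : C) :
  0 < orient a b z -> locally z (fun y => 0 < orient a b y).
Proof.
  intros Ho.
  set (m := Rabs (Re b - Re a) + Rabs (Im b - Im a) + 1).
  pose proof (Rabs_pos (Re b - Re a)) as Hx; pose proof (Rabs_pos (Im b - Im a)) as Hy.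
  assert (Hm : 0 < m) by (unfold m; lra).
  assert (He : 0 < orient a b z / m) by now apply Rdiv_lt_0_compat.
  exists (mkposreal _ He); intros y [Hy1 Hy2].
  change (Rabs (fst y - fst z) < orient a b z / m) in Hy1.
  change (Rabs (snd y - snd z) < orient a b z / m) in Hy2.
  set (eps := orient a b z / m) in *.
  assert (E : orient a b z = eps * m) by (unfold eps; field; lra).
  replace (orient a b y) with (orient a b z +
    ((Re b - Re a) * (snd y - snd z) - (Im b - Im a) * (fst y - fst z)))
    by (unfold orient, Re, Im; ring).
  assert (H1 : Rabs ((Re b - Re a) * (snd y - snd z)) <= Rabs (Re b - Re a) * eps)
    by (rewrite Rabs_mult; apply Rmult_le_compat_l; lra).
  assert (H2 : Rabs ((Im b - Im a) * (fst y - fst z)) <= Rabs (Im b - Im a) * eps)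
    by (rewrite Rabs_mult; apply Rmult_le_compat_l; lra).
  apply Rabs_le_between in H1, H2; unfold m in E; nra.
Qed.

Lemma in_open_locally (g : motion) (t : triangle) (z : C) :
  in_open g t z -> locally z (in_open g t).
Proof.
  destruct t as [[i j] k]; intros H; apply in_open_triangle in H.
  destruct H as (H1 & H2 & H3).
  apply orient_locally in H1, H2, H3.
  generalize (filter_and _ _ H1 (filter_and _ _ H2 H3)); apply filter_imp.
  intros y (?&?&?); apply in_open_triangle; repeat split; easy.
Qed.

Lemma in_open_interior (g : motion) (t : triangle) (z : C) :
  isometry g -> In t triangles -> in_open g t z -> interior (tile g) z.
Proof.
  intros Hg Ht Ho; apply in_open_locally in Ho; unfold interior; revert Ho.
  apply filter_imp.
  intros y; now apply tile_open.
Qed.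

(** * Local finiteness *)

(** All that is used of a tiling from here on; interiors and the even-odd rule for tiles are
    replaced by sign conditions on triangles. *)
Record piece_tiling (T : motion -> Prop) : Prop := {
  pieces_isometry : forall g, T g -> isometry g;
  pieces_cover : forall z, exists g t, T g /\ In t triangles /\ in_closed g t z;
  pieces_disjoint : forall g h t t' z, T g -> T h -> In t triangles -> In t' triangles ->
    in_open g t z -> in_open h t' z -> g = h }.

Lemma spectre_tiling_pieces (T : motion -> Prop) : spectre_tiling T -> piece_tiling T.
Proof.
  intros (HI & HC & HD); split.
  - exact HI.
  - intros z; destruct (HC z) as (g & Hg & Hz).
    destruct (tile_closed g z (HI g Hg) Hz) as (t & Ht & Ho); now exists g, t.
  - intros g h t t' z Hg Hh Ht Ht' Ho Ho'; apply NNPP; intros Hne.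
    apply (HD g h Hg Hh Hne z); split.
    + now apply (in_open_interior g t); [apply HI| |].
    + now apply (in_open_interior h t'); [apply HI| |].
Qed.

(** The centroid of the triangle (8, 2, 1), around which each tile keeps a square free of the other
    tiles. *)
Definition center (g : motion) : C :=
  Cmult (RtoC (1 / 3)) (Cplus (pt g 8) (Cplus (pt g 2) (pt g 1))).

Definition close (r : R) (a b : C) : Prop :=
  Rabs (Re a - Re b) <= r /\ Rabs (Im a - Im b) <= r.

Lemma Rabs_le_sq (x r : R) : 0 <= r -> x * x <= r * r -> Rabs x <= r.
Proof.
  intros Hr Hx; rewrite <- (Rabs_pos_eq r Hr); apply Rsqr_le_abs_0; exact Hx.
Qed.

Lemma isometry_bound (g : motion) (e : C) (r : R) :
  isometry g -> 0 <= r -> Re e * Re e + Im e * Im e <= r * r ->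
  Rabs (Re (Cmult (fst g) e)) <= r /\ Rabs (Im (Cmult (fst g) e)) <= r.
Proof.
  intros Hg Hr He; apply isometry_sq in Hg.
  destruct g as [[a b] c], e as [x y]; unfold Re, Im in *; simpl in *.
  assert (E : (a * x - b * y) * (a * x - b * y) + (a * y + b * x) * (a * y + b * x)
    <= r * r).
  { replace (_ + _) with ((a * a + b * b) * (x * x + y * y)) by ring.
    rewrite Hg; lra. }
  pose proof (Rle_0_sqr (a * x - b * y)); pose proof (Rle_0_sqr (a * y + b * x)).
  unfold Rsqr in *; split; apply Rabs_le_sq; lra.
Qed.

Lemma pt_minus (g : motion) (a b : nat) :
  Cminus (pt g a) (pt g b) = Cmult (fst g) (lval (lsub (vertex a) (vertex b))).
Proof. unfold pt; now rewrite act_minus, lval_sub. Qed.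

Lemma pt_close (g : motion) (a b : nat) :
  isometry g -> (a < 14)%nat -> (b < 14)%nat -> close 5 (pt g a) (pt g b).
Proof.
  intros Hg Ha Hb.
  (* [lcross x (lrot 3 x)] is four times the squared length of x, and 100 = 4 * 5^2. *)
  assert (H : forallb (fun a => forallb (fun b =>
    let x := lsub (vertex a) (vertex b) in let n := lcross x (lrot 3 x) in
    snonpos (fst n - 100, snd n)%Z) (seq 0 14)) (seq 0 14) = true)
    by (vm_compute; reflexivity).
  rewrite forallb_forall in H; specialize (H a); rewrite in_seq in H.
  specialize (H ltac:(lia)); rewrite forallb_forall in H.
  specialize (H b); rewrite in_seq in H; specialize (H ltac:(lia)); cbv zeta in H.
  set (x := lsub (vertex a) (vertex b)) in H; apply snonpos_le in H.
  pose proof (lcross_val x (lrot 3 x)) as E; rewrite lval_rot, zeta_3 in E.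
  unfold sval, cross in *; cbn [fst snd] in H; rewrite minus_IZR in H.
  assert (Hx : Re (lval x) * Re (lval x) + Im (lval x) * Im (lval x) <= 5 * 5)
    by (unfold Re, Im in *; cbn [fst snd Cmult] in *; lra).
  apply (isometry_bound g) in Hx; [|easy|lra].
  unfold x in Hx; rewrite <- pt_minus in Hx; exact Hx.
Qed.

Lemma pt_close_center (g : motion) (a : nat) :
  isometry g -> (a < 14)%nat -> close 5 (pt g a) (center g).
Proof.
  intros Hg Ha.
  pose proof (pt_close g a 8 Hg Ha ltac:(lia)) as H1.
  pose proof (pt_close g a 2 Hg Ha ltac:(lia)) as H2.
  pose proof (pt_close g a 1 Hg Ha ltac:(lia)) as H3.
  unfold close, center, Re, Im in *; simpl in *.
  destruct H1 as [H1 H1'], H2 as [H2 H2'], H3 as [H3 H3'].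
  apply Rabs_le_between in H1, H2, H3, H1', H2', H3'.
  split; apply Rabs_le; lra.
Qed.

Lemma in_closed_center (g : motion) (t : triangle) (z : C) :
  isometry g -> In t triangles -> in_closed g t z -> close 5 z (center g).
Proof.
  destruct t as [[i j] k]; intros Hg Ht Hz.
  assert (Hb : (i < 14 /\ j < 14 /\ k < 14)%nat)
    by (simpl in Ht; repeat destruct Ht as [Ht|Ht]; try easy; injection Ht as <- <- <-; lia).
  pose proof (triangles_ccw g _ _ _ Hg Ht) as HD; apply in_closed_triangle in Hz.
  destruct Hb as (Hi & Hj & Hk).
  apply (pt_close_center g) in Hi, Hj, Hk; try easy.
  pose proof (orient_sum (pt g i) (pt g j) (pt g k) z) as HS.
  pose proof (orient_height (pt g i) (pt g j) (pt g k) z) as HH.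
  assert (HW : orient (pt g j) (pt g k) z * (Re (pt g i) - Re z)
    + orient (pt g k) (pt g i) z * (Re (pt g j) - Re z)
    + orient (pt g i) (pt g j) z * (Re (pt g k) - Re z) = 0) by (unfold orient; ring).
  destruct Hz as (H1 & H2 & H3), Hi as [Hi Hi'], Hj as [Hj Hj'], Hk as [Hk Hk'].
  apply Rabs_le_between in Hi, Hi', Hj, Hj', Hk, Hk'.
  generalize dependent (orient (pt g j) (pt g k) z).
  generalize dependent (orient (pt g k) (pt g i) z).
  generalize dependent (orient (pt g i) (pt g j) z).
  generalize dependent (orient (pt g i) (pt g j) (pt g k)).
  intros D HD w Hw v Hv u HS HH Hu HW.
  split; apply Rabs_le; split; apply Rnot_lt_le; intros Hn; nra.
Qed.

(* Any radius below the inradius of the triangle (8, 2, 1) would do. *)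
Lemma center_open (g : motion) (z : C) :
  isometry g -> Rabs (Re z - Re (center g)) < 1 / 20 ->
  Rabs (Im z - Im (center g)) < 1 / 20 -> in_open g (8, 2, 1)%nat z.
Proof.
  intros Hg Hx Hy a b Hs.
  pose proof (triangles_ccw g 8 2 1 Hg ltac:(simpl; tauto)) as HD.
  (* At the centroid each side has a third of this value, more than 1/2. A displacement below 1/20
     in both coordinates changes it by at most 2 * 5 / 20 = 1/2. *)
  assert (HD' : 3 / 2 < orient (pt g 8) (pt g 2) (pt g 1)).
  { assert (H : spos (fst (lo 8 2 1) - 6, snd (lo 8 2 1))%Z = true)
      by (vm_compute; reflexivity).
    apply spos_pos in H; unfold sval in H; cbn [fst snd] in H; rewrite minus_IZR in H.
    pose proof (lo_val g 8 2 1 Hg) as H'; unfold sval in H'; lra. }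
  assert (Hc : close 5 (pt g b) (pt g a)).
  { destruct Hs as [H|[H|[H|[]]]]; injection H as <- <-; apply pt_close; easy || lia. }
  assert (E : orient (pt g a) (pt g b) z = orient (pt g 8) (pt g 2) (pt g 1) / 3
    + cross (Cminus (pt g b) (pt g a)) (Cminus z (center g))).
  { destruct Hs as [H|[H|[H|[]]]]; injection H as <- <-;
      unfold orient, cross, center, Re, Im; simpl; field. }
  rewrite E; destruct Hc as [H1 H2].
  unfold cross, Re, Im in *; simpl in *.
  apply Rabs_def2 in Hx, Hy; apply Rabs_le_between in H1, H2.
  nra.
Qed.

(** Excluded middle decides for each key in the list whether an element of X carries it, and by
    injectivity there is at most one. *)
Lemma finite_by_key {A B : Type} (X : A -> Prop) (key : A -> B) (l : list B) :
  (forall x y, X x -> X y -> key x = key y -> x = y) ->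
  exists L, forall x, In x L <-> X x /\ In (key x) l.
Proof.
  intros Hinj; induction l as [|b l (L & HL)]; [exists []; simpl; tauto|].
  destruct (classic (exists x, X x /\ key x = b)) as [(x & Hx & <-)|Hn].
  - exists (x :: L); intros y; simpl; rewrite HL; split.
    + intros [<-|[H1 H2]]; tauto.
    + intros [Hy [E|H]]; [left; now apply Hinj | tauto].
  - exists L; intros y; rewrite HL; simpl; split; [tauto|].
    intros [Hy [E|H]]; [exfalso; apply Hn; now exists y | tauto].
Qed.

(** The mesh 1/20 is the one for which two centres in the same cell are within the reach of
    [center_open]. *)
Definition cell (z : C) : Z * Z := (up (20 * Re z), up (20 * Im z)).

Lemma up_eq_close (x y : R) : up (20 * x) = up (20 * y) -> Rabs (x - y) < 1 / 20.
Proof.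
  intros E; destruct (archimed (20 * x)) as [H1 H2], (archimed (20 * y)) as [H3 H4].
  rewrite E in H1, H2; apply Rabs_def1; lra.
Qed.

(** A window of 141 = 20 * 7 + 1 cells to either side; the extra one absorbs the rounding. *)
Definition zrange (x : R) : list Z :=
  map (fun n => up (20 * x) - 141 + Z.of_nat n)%Z (seq 0 283).

Lemma up_in_zrange (x y : R) : Rabs (y - x) <= 7 -> In (up (20 * y)) (zrange x).
Proof.
  intros H; apply Rabs_le_between in H.
  destruct (archimed (20 * x)) as [H1 H2], (archimed (20 * y)) as [H3 H4].
  assert (Hl : (up (20 * x) - 141 < up (20 * y))%Z)
    by (apply lt_IZR; rewrite minus_IZR; lra).
  assert (Hu : (up (20 * y) < up (20 * x) + 141)%Z)
    by (apply lt_IZR; rewrite plus_IZR; lra).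
  apply in_map_iff; exists (Z.to_nat (up (20 * y) - (up (20 * x) - 141))).
  rewrite in_seq; split; lia.
Qed.

(** Two tiles whose centres lie in one cell overlap, hence coincide. A tile that comes within 1 of z
    has its centre within 5 + 1 of z in each coordinate, so only finitely many cells matter. *)
Lemma locally_finite (T : motion -> Prop) (z : C) :
  piece_tiling T -> exists L, (forall g, In g L -> T g) /\
    forall g t y, T g -> In t triangles -> in_closed g t y -> close 1 y z -> In g L.
Proof.
  intros HT.
  destruct (finite_by_key T (fun g => cell (center g))
    (list_prod (zrange (Re z)) (zrange (Im z)))) as (L & HL).
  - intros g h Hg Hh E; injection E as E1 E2.
    apply up_eq_close in E1, E2.
    apply (pieces_disjoint T HT g h (8, 2, 1)%nat (8, 2, 1)%nat (center g));
      try easy; try (simpl; tauto); apply center_open; try easy;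
      try now apply (pieces_isometry T HT).
    + rewrite Rminus_diag, Rabs_R0; lra.
    + rewrite Rminus_diag, Rabs_R0; lra.
  - exists L; split; [intros g Hg; now apply HL|].
    intros g t y Hg Ht Hy [Hx1 Hx2]; apply HL; split; [easy|].
    destruct (in_closed_center g t y) as [H1 H2]; try easy;
      [now apply (pieces_isometry T HT)|].
    apply Rabs_le_between in H1, H2, Hx1, Hx2.
    apply in_prod; apply up_in_zrange; apply Rabs_le; lra.
Qed.

(** * Germs of curves *)

Definition small (Q : R -> Prop) : Prop :=
  exists e, 0 < e /\ forall s, 0 < s < e -> Q s.

Lemma small_and (Q Q' : R -> Prop) : small Q -> small Q' -> small (fun s => Q s /\ Q' s).
Proof.
  intros (e & He & H) (e' & He' & H'); exists (Rmin e e'); split.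
  - now apply Rmin_pos.
  - intros s Hs; pose proof (Rmin_l e e'); pose proof (Rmin_r e e').
    split; [apply H | apply H']; lra.
Qed.

Lemma small_imp (Q Q' : R -> Prop) : (forall s, Q s -> Q' s) -> small Q -> small Q'.
Proof. intros HQ (e & He & H); exists e; split; [easy|]; intros s Hs; apply HQ; auto. Qed.

Lemma small_exists (Q : R -> Prop) : small Q -> exists s, 0 < s /\ Q s.
Proof. intros (e & He & H); exists (e / 2); split; [lra|]; apply H; lra. Qed.

Lemma small_lt (e : R) : 0 < e -> small (fun s => s < e).
Proof. intros He; exists e; split; [easy|]; intros; lra. Qed.

Lemma small_list {A : Type} (l : list A) (Q : A -> R -> Prop) :
  (forall x, In x l -> small (Q x)) -> small (fun s => forall x, In x l -> Q x s).
Proof.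
  induction l as [|x l IH]; intros H.
  - exists 1; split; [lra|easy].
  - generalize (small_and _ _ (H x (or_introl eq_refl))
      (IH (fun y Hy => H y (or_intror Hy)))).
    apply small_imp; intros s [H1 H2] y [<-|Hy]; auto.
Qed.

Definition lexpos (a b c : R) : Prop := 0 < a \/ a = 0 /\ (0 < b \/ b = 0 /\ 0 < c).
Definition lexneg (a b c : R) : Prop := a < 0 \/ a = 0 /\ (b < 0 \/ b = 0 /\ c < 0).

Lemma small_lexpos (a b c : R) : lexpos a b c -> small (fun s => 0 < a + s * b + s * s * c).
Proof.
  pose proof (Rabs_pos b) as Hb; pose proof (Rabs_pos c) as Hc.
  pose proof (Rle_abs (- b)) as Hb'; pose proof (Rle_abs (- c)) as Hc'.
  rewrite Rabs_Ropp in Hb', Hc'.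
  assert (S1 : small (fun s => s < 1)) by (apply small_lt; lra).
  intros [Ha|(-> & [Hb0|(-> & Hc0)])].
  - assert (He : 0 < a / (Rabs b + Rabs c + 1)) by (apply Rdiv_lt_0_compat; lra).
    destruct (small_and _ _ S1 (small_lt _ He)) as (e & Hpos & H).
    exists e; split; [easy|]; intros s Hs; destruct (H s Hs) as [H1 H2].
    apply Rlt_div_r in H2; [|lra].
    assert (s * s <= s) by nra.
    assert (- s * Rabs b <= s * b) by (clear - Hs Hb Hb'; nra).
    assert (- s * Rabs c <= s * s * c) by nra.
    nra.
  - assert (He : 0 < b / (Rabs c + 1)) by (apply Rdiv_lt_0_compat; lra).
    destruct (small_lt _ He) as (e & Hpos & H).
    exists e; split; [easy|]; intros s Hs; specialize (H s Hs).
    apply Rlt_div_r in H; [|lra].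
    assert (0 < b + s * c) by nra; nra.
  - exists 1; split; [lra|]; intros s Hs.
    assert (0 < s * s * c) by (repeat apply Rmult_lt_0_compat; lra); lra.
Qed.

Lemma small_lexneg (a b c : R) : lexneg a b c -> small (fun s => a + s * b + s * s * c < 0).
Proof.
  intros H; assert (H' : lexpos (- a) (- b) (- c)).
  { destruct H as [H|(-> & [H|(-> & H)])]; unfold lexpos;
      [left | right; split; [|left] | right; split; [|right; split]]; lra. }
  apply small_lexpos in H'; revert H'; apply small_imp; intros s Hs; nra.
Qed.

(** It leaves z in direction u, and the second-order term pushes it off the ray to the side of v.
    Thus it models the points just beside the ray and tells the two sides of an edge along the ray
    apart. *)
Definition curve (z u v : C) (s : R) : C :=
  Cplus z (Cplus (Cmult (RtoC s) u) (Cmult (RtoC (s * s)) v)).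

Lemma orient_curve (a b z u v : C) (s : R) :
  orient a b (curve z u v s) =
  orient a b z + s * cross (Cminus b a) u + s * s * cross (Cminus b a) v.
Proof.
  destruct a, b, z, u, v; unfold curve, orient, cross, Re, Im; simpl; ring.
Qed.

Definition germ_open (g : motion) (t : triangle) (z u v : C) : Prop :=
  small (fun s => in_open g t (curve z u v s)).
Definition germ_closed (g : motion) (t : triangle) (z u v : C) : Prop :=
  small (fun s => in_closed g t (curve z u v s)).
Definition germ_outside (g : motion) (t : triangle) (z u v : C) : Prop :=
  small (fun s => ~ in_closed g t (curve z u v s)).

Definition side_lexpos (g : motion) (s : nat * nat) (z u v : C) : Prop :=
  let (a, b) := s in
  lexpos (orient (pt g a) (pt g b) z) (cross (Cminus (pt g b) (pt g a)) u)
    (cross (Cminus (pt g b) (pt g a)) v).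
Definition side_lexneg (g : motion) (s : nat * nat) (z u v : C) : Prop :=
  let (a, b) := s in
  lexneg (orient (pt g a) (pt g b) z) (cross (Cminus (pt g b) (pt g a)) u)
    (cross (Cminus (pt g b) (pt g a)) v).

Lemma germ_open_lex (g : motion) (t : triangle) (z u v : C) :
  (forall s, In s (sides t) -> side_lexpos g s z u v) -> germ_open g t z u v.
Proof.
  intros H; apply small_imp with (fun r => forall s, In s (sides t) ->
    0 < orient (pt g (fst s)) (pt g (snd s)) (curve z u v r)).
  - intros r Hr a b Hs; exact (Hr _ Hs).
  - apply small_list; intros [a b] Hs; specialize (H _ Hs); cbn [fst snd].
    apply small_lexpos in H; revert H; apply small_imp; intros r; now rewrite orient_curve.
Qed.

Lemma germ_outside_lex (g : motion) (t : triangle) (s : nat * nat) (z u v : C) :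
  In s (sides t) -> side_lexneg g s z u v -> germ_outside g t z u v.
Proof.
  destruct s as [a b]; intros Hs H; apply small_lexneg in H; revert H; apply small_imp.
  intros r Hr Hc; specialize (Hc _ _ Hs); rewrite orient_curve in Hc; lra.
Qed.

(** Each side gives a quadratic polynomial in s, which has a constant sign for small s > 0; the
    curve cannot enter and leave a triangle again and again. *)
Lemma germ_dichotomy (g : motion) (t : triangle) (z u v : C) :
  germ_closed g t z u v \/ germ_outside g t z u v.
Proof.
  destruct (classic (exists s, In s (sides t) /\ side_lexneg g s z u v))
    as [(s & Hs & H)|H]; [right; now apply germ_outside_lex with s|left].
  apply small_imp with (fun r => forall s, In s (sides t) ->
    0 <= orient (pt g (fst s)) (pt g (snd s)) (curve z u v r)).
  - intros r Hr a b Hs; exact (Hr _ Hs).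
  - apply small_list; intros [a b] Hs; cbn [fst snd].
    assert (Hn : ~ side_lexneg g (a, b) z u v) by (intros Hn; apply H; now exists (a, b)).
    unfold side_lexneg in Hn.
    apply small_imp with (fun s => 0 <= orient (pt g a) (pt g b) z
      + s * cross (Cminus (pt g b) (pt g a)) u
      + s * s * cross (Cminus (pt g b) (pt g a)) v); [intros r; now rewrite orient_curve|].
    set (x := orient _ _ _) in *; set (x' := cross _ u) in *; set (x'' := cross _ v) in *.
    assert (Hx : lexpos x x' x'' \/ x = 0 /\ x' = 0 /\ x'' = 0).
    { unfold lexneg, lexpos in *.
      destruct (Rtotal_order x 0) as [?|[?|?]], (Rtotal_order x' 0) as [?|[?|?]],
        (Rtotal_order x'' 0) as [?|[?|?]]; tauto || lra. }
    destruct Hx as [Hx|(-> & -> & ->)].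
    + apply small_lexpos in Hx; revert Hx; apply small_imp; intros r; lra.
    + exists 1; split; [lra|]; intros r _; lra.
Qed.

Lemma germ_closed_lex (g : motion) (t : triangle) (s : nat * nat) (z u v : C) :
  In s (sides t) -> germ_closed g t z u v -> ~ side_lexneg g s z u v.
Proof.
  intros Hs Hc Hn; apply (germ_outside_lex g t) in Hn; [|easy].
  destruct (small_exists _ (small_and _ _ Hc Hn)) as (r & _ & H1 & H2); easy.
Qed.

Lemma curve_close (z u v : C) : small (fun s => close 1 (curve z u v s) z).
Proof.
  assert (H : forall x y : R, small (fun s => Rabs (s * x + s * s * y) <= 1)).
  { intros x y.
    assert (H1 := small_lexpos 1 x y ltac:(left; lra)).
    assert (H2 := small_lexpos 1 (- x) (- y) ltac:(left; lra)).
    generalize (small_and _ _ H1 H2); apply small_imp; intros s [H3 H4].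
    apply Rabs_le; lra. }
  generalize (small_and _ _ (H (Re u) (Re v)) (H (Im u) (Im v))); apply small_imp.
  intros s [H1 H2]; unfold close, curve.
  replace (Re _ - Re z) with (s * Re u + s * s * Re v) by (unfold Re; simpl; ring).
  replace (Im _ - Im z) with (s * Im u + s * s * Im v) by (unfold Im; simpl; ring).
  easy.
Qed.

(** If the curve were outside each of the finitely many triangles nearby, one small parameter would
    give a point outside all of them, which is not covered. *)
Lemma germ_cover (T : motion -> Prop) (z u v : C) :
  piece_tiling T -> exists g t, T g /\ In t triangles /\ germ_closed g t z u v.
Proof.
  intros HT; destruct (locally_finite T z HT) as (L & HL & HL').
  apply NNPP; intros Hn.
  assert (H : small (fun s => forall gt, In gt (list_prod L triangles) ->
    ~ in_closed (fst gt) (snd gt) (curve z u v s))).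
  { apply small_list; intros [g t] Hgt; apply in_prod_iff in Hgt; destruct Hgt as [Hg Ht].
    destruct (germ_dichotomy g t z u v) as [H|H]; [|exact H].
    exfalso; apply Hn; exists g, t; auto. }
  destruct (small_exists _ (small_and _ _ H (curve_close z u v))) as (s & _ & H1 & H2).
  destruct (pieces_cover T HT (curve z u v s)) as (g & t & Hg & Ht & Hz).
  apply (H1 (g, t)); [|exact Hz].
  apply in_prod; [|easy]; now apply (HL' g t (curve z u v s)).
Qed.

(** * The tile across an edge *)

(* A point moving from z in direction u runs along the segment from a to b, in one
   or the other direction. *)
Definition along (a b z u : C) : Prop := exists t r : R,
  z = Cplus a (Cmult (RtoC t) (Cminus b a)) /\ u = Cmult (RtoC r) (Cminus b a) /\
  0 <= t <= 1 /\ r <> 0 /\ (t = 0 -> 0 < r) /\ (t = 1 -> r < 0).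

Lemma along_sym (a b z u : C) : along a b z u -> along b a z u.
Proof.
  intros (t & r & -> & -> & Ht & Hr & H0 & H1); exists (1 - t), (- r).
  split; [destruct a, b; C_ext; ring|].
  split; [destruct a, b; C_ext; ring|].
  split; [lra|split; [lra|split; intros E]].
  - assert (r < 0) by (apply H1; lra); lra.
  - assert (0 < r) by (apply H0; lra); lra.
Qed.

(** Names the corner opposite a given side, so that the three cyclic positions of the side are
    treated at once. *)
Lemma side_third (t : triangle) (a b : nat) :
  In (a, b) (sides t) -> exists c,
    (forall s, In s (sides t) <-> s = (a, b) \/ s = (b, c) \/ s = (c, a)) /\
    (forall g, isometry g -> In t triangles -> 0 < orient (pt g a) (pt g b) (pt g c)).
Proof.
  destruct t as [[i j] k]; intros [H|[H|[H|[]]]]; injection H as <- <-;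
    [exists k|exists i|exists j]; split;
    try (intros g Hg Ht; apply (triangles_ccw g) in Ht; [|easy]);
    try (intros s; simpl; split; intros H; repeat destruct H as [H|H]; subst; tauto).
  - exact Ht.
  - now rewrite orient_rot.
  - now rewrite <- orient_rot.
Qed.

Lemma orient_on_line (a b c d : C) (t : R) :
  orient c d (Cplus a (Cmult (RtoC t) (Cminus b a))) =
  (1 - t) * orient c d a + t * orient c d b.
Proof. destruct a, b, c, d; unfold orient, Re, Im; simpl; ring. Qed.

Lemma cross_on_line (a b c d : C) (r : R) :
  cross (Cminus d c) (Cmult (RtoC r) (Cminus b a)) = r * (orient c d b - orient c d a).
Proof. destruct a, b, c, d; unfold orient, cross, Re, Im; simpl; ring. Qed.

Lemma orient_aba (a b : C) : orient a b a = 0.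
Proof. unfold orient; ring. Qed.

Lemma orient_abb (a b : C) : orient a b b = 0.
Proof. unfold orient; ring. Qed.

(** For the side itself the first two coefficients vanish and v decides. The other two sides are
    positive at z or, at an endpoint, to first order, because u points into the segment. *)
Lemma germ_open_along (g : motion) (t : triangle) (a b : nat) (z u v : C) :
  isometry g -> In t triangles -> In (a, b) (sides t) ->
  along (pt g a) (pt g b) z u -> 0 < cross (Cminus (pt g b) (pt g a)) v ->
  germ_open g t z u v.
Proof.
  intros Hg Ht Hs (x & r & -> & -> & Hx & Hr & H0 & H1) Hv.
  destruct (side_third t a b Hs) as (c & Hc & HD); specialize (HD g Hg Ht).
  apply germ_open_lex; intros s Hs'; apply Hc in Hs'.
  destruct Hs' as [->|[->| ->]]; unfold side_lexpos, lexpos;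
    rewrite orient_on_line, cross_on_line, ?orient_aba, ?orient_abb.
  - right; split; [ring|right; split; [ring|easy]].
  - rewrite (orient_rot (pt g a)).
    destruct (Req_dec x 1) as [->|Hx1]; [right; split; [ring|left] | left].
    + specialize (H1 eq_refl); nra.
    + nra.
  - rewrite <- (orient_rot (pt g c)).
    destruct (Req_dec x 0) as [->|Hx0]; [right; split; [ring|left] | left].
    + specialize (H0 eq_refl); nra.
    + nra.
Qed.

Lemma germ_open_midpoint (g : motion) (t : triangle) (a b : nat) (x : R) (w : C) :
  isometry g -> In t triangles -> In (a, b) (sides t) -> 0 < x < 1 ->
  0 < cross (Cminus (pt g b) (pt g a)) w ->
  germ_open g t (Cplus (pt g a) (Cmult (RtoC x) (Cminus (pt g b) (pt g a)))) w 0.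
Proof.
  intros Hg Ht Hs Hx Hw.
  destruct (side_third t a b Hs) as (c & Hc & HD); specialize (HD g Hg Ht).
  apply germ_open_lex; intros s Hs'; apply Hc in Hs'.
  destruct Hs' as [->|[->| ->]]; unfold side_lexpos, lexpos;
    rewrite orient_on_line, ?orient_aba, ?orient_abb.
  - right; split; [ring|left; easy].
  - rewrite (orient_rot (pt g a)); left; nra.
  - rewrite <- (orient_rot (pt g c)); left; nra.
Qed.

Lemma collinear (e x : C) :
  e <> 0 -> cross e x = 0 -> exists r : R, x = Cmult (RtoC r) e.
Proof.
  destruct e as [e1 e2], x as [x1 x2]; unfold cross, Re, Im; simpl; intros He Hx.
  destruct (Req_dec e1 0) as [->|H1].
  - assert (e2 <> 0) by (intros ->; now apply He).
    exists (x2 / e2); C_ext; [|field; lra].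
    assert (x1 * e2 = 0) by lra.
    assert (x1 = 0) by (destruct (Rmult_integral x1 e2); lra || easy).
    subst; ring.
  - exists (x1 / e1); C_ext; [field; lra|].
    apply Rmult_eq_reg_l with e1; [|easy]; field_simplify; lra.
Qed.

(** Either the ray enters the interior of t, and v is irrelevant, or some side is not cleared to
    first order. Then z and u lie on the line of this side, the other two sides confine z and u to
    the segment, and v is on the inner side since it is not parallel to u. *)
Lemma germ_closed_cases (g : motion) (t : triangle) (z u v : C) :
  isometry g -> In t triangles -> cross u v <> 0 -> germ_closed g t z u v ->
  (forall v', germ_open g t z u v') \/
  exists a b, In (a, b) (sides t) /\ along (pt g a) (pt g b) z u /\
    0 < cross (Cminus (pt g b) (pt g a)) v.
Proof.
  intros Hg Ht Huv Hc.
  (* With 0 as the second-order term, [lexpos] asks for positivity within first order, which carries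
     over to every v'. *)
  destruct (classic (forall s, In s (sides t) -> side_lexpos g s z u 0)) as [H|H].
  { left; intros v'; apply germ_open_lex; intros [a b] Hs; specialize (H _ Hs).
    unfold side_lexpos, lexpos in *.
    replace (cross (Cminus (pt g b) (pt g a)) 0) with 0 in H
      by (unfold cross, Re, Im; simpl; ring).
    lra. }
  right; apply not_all_ex_not in H; destruct H as ([a b] & H).
  apply imply_to_and in H; destruct H as [Hs H]; exists a, b; split; [easy|].
  pose proof (germ_closed_lex g t (a, b) z u v Hs Hc) as Hn.
  destruct (side_third t a b Hs) as (c & Hsides & HD); specialize (HD g Hg Ht).
  assert (Hbc : ~ side_lexneg g (b, c) z u v)
    by (apply (germ_closed_lex g t); [apply Hsides; tauto|easy]).
  assert (Hca : ~ side_lexneg g (c, a) z u v)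
    by (apply (germ_closed_lex g t); [apply Hsides; tauto|easy]).
  unfold side_lexneg, side_lexpos, lexneg, lexpos in *.
  replace (cross (Cminus (pt g b) (pt g a)) 0) with 0 in H
    by (unfold cross, Re, Im; simpl; ring).
  assert (Hz0 : orient (pt g a) (pt g b) z = 0) by lra.
  assert (Hu0 : cross (Cminus (pt g b) (pt g a)) u = 0) by lra.
  assert (He : Cminus (pt g b) (pt g a) <> 0).
  { intros E; rewrite orient_cross, E in HD; unfold cross, Re, Im in HD; simpl in HD; lra. }
  destruct (collinear _ u He Hu0) as (r & Hr).
  rewrite orient_cross in Hz0; destruct (collinear _ _ He Hz0) as (x & Hx).
  assert (Hz : z = Cplus (pt g a) (Cmult (RtoC x) (Cminus (pt g b) (pt g a))))
    by (rewrite <- Hx; ring).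
  assert (Hr0 : r <> 0).
  { intros ->; apply Huv; rewrite Hr; unfold cross, Re, Im; simpl; ring. }
  rewrite Hz in Hbc, Hca; rewrite Hr in Hbc, Hca.
  rewrite orient_on_line, cross_on_line, orient_aba, (orient_rot (pt g a)) in Hbc.
  rewrite orient_on_line, cross_on_line, orient_abb, <- (orient_rot (pt g c)) in Hca.
  set (D := orient (pt g a) (pt g b) (pt g c)) in *.
  assert (Hx1 : x <= 1) by (apply Rnot_lt_le; intros Hx1; apply Hbc; left; nra).
  assert (Hx0 : 0 <= x) by (apply Rnot_lt_le; intros Hx0; apply Hca; left; nra).
  split.
  - exists x, r; repeat split; try easy.
    + intros ->; apply Rnot_le_lt; intros Hr1; apply Hca; right; split; [ring|left].
      assert (r < 0) by lra; nra.
    + intros ->; apply Rnot_le_lt; intros Hr1; apply Hbc; right; split; [ring|left].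
      assert (0 < r) by lra; nra.
  - assert (cross u v = r * cross (Cminus (pt g b) (pt g a)) v)
      by (rewrite Hr; unfold cross, Re, Im; simpl; ring).
    assert (cross (Cminus (pt g b) (pt g a)) v <> 0) by (intros E; rewrite E in *; lra).
    lra.
Qed.

Lemma edge_or_diagonal (t : triangle) (a b : nat) :
  In t triangles -> In (a, b) (sides t) ->
  (exists k, (k < 14)%nat /\ a = next k /\ b = k) \/
  (exists t', In t' triangles /\ In (b, a) (sides t')).
Proof.
  intros Ht Hs.
  assert (H : forallb (fun t => forallb (fun s : nat * nat => let (a, b) := s in
    ((b <? 14)%nat && (a =? next b)%nat) ||
    existsb (fun t' => existsb (fun s' : nat * nat => let (a', b') := s' in
      (a' =? b)%nat && (b' =? a)%nat) (sides t')) triangles) (sides t)) triangles = true)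
    by (vm_compute; reflexivity).
  rewrite forallb_forall in H; specialize (H _ Ht).
  rewrite forallb_forall in H; specialize (H _ Hs); cbv beta iota in H.
  rewrite orb_true_iff, andb_true_iff, Nat.ltb_lt, Nat.eqb_eq, existsb_exists in H.
  destruct H as [[H1 H2]|(t' & Ht' & H)]; [left; now exists b|right].
  exists t'; split; [easy|]; rewrite existsb_exists in H; destruct H as ([a' b'] & Hs' & H).
  rewrite andb_true_iff, !Nat.eqb_eq in H; destruct H as [-> ->]; easy.
Qed.

(* If g lies on the one side of the ray from z in direction u and not on the other,
   then the tile h on the other side has an edge along the ray: the ray cannot run
   through the interior of h, nor along a diagonal of its triangulation, without h
   overlapping g. *)
Lemma next_tile (T : motion -> Prop) (g : motion) (t : triangle) (z u v : C) :
  piece_tiling T -> T g -> In t triangles -> germ_open g t z u (Copp v) ->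
  (forall t', In t' triangles -> germ_outside g t' z u v) -> cross u v <> 0 ->
  exists h t' k, T h /\ In t' triangles /\ germ_closed h t' z u v /\ h <> g /\
    (k < 14)%nat /\ along (pt h k) (pt h (next k)) z u /\
    0 < cross (Cminus (pt h k) (pt h (next k))) v.
Proof.
  intros HT Hg Ht Ho Hout Huv.
  destruct (germ_cover T z u v HT) as (h & t' & Hh & Ht' & Hc).
  assert (Hne : h <> g).
  { intros ->; destruct (small_exists _ (small_and _ _ Hc (Hout t' Ht')))
      as (s & _ & H1 & H2); easy. }
  assert (Hno : forall t'', In t'' triangles -> ~ germ_open h t'' z u (Copp v)).
  { intros t'' Ht'' H; apply Hne.
    destruct (small_exists _ (small_and _ _ H Ho)) as (s & _ & H1 & H2).
    now apply (pieces_disjoint T HT h g t'' t (curve z u (Copp v) s)). }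
  assert (Hi : isometry h) by now apply (pieces_isometry T HT).
  destruct (germ_closed_cases h t' z u v Hi Ht' Huv Hc) as [H|(a & b & Hs & Ha & Hv)].
  { exfalso; now apply (Hno t'). }
  destruct (edge_or_diagonal t' a b Ht' Hs) as [(k & Hk & -> & ->)|(t'' & Ht'' & Hs')].
  - exists h, t', k; repeat split; try easy; now apply along_sym.
  - exfalso; apply (Hno t'' Ht'').
    apply (germ_open_along h t'' b a); try easy; [now apply along_sym|].
    replace (cross _ _) with (cross (Cminus (pt h b) (pt h a)) v); [easy|].
    unfold cross, Re, Im; simpl; ring.
Qed.

(* A side of t keeps the edge k on its outer side; if it contains the edge, then it
   is the edge. *)
Definition edge_separated (k : nat) (t : triangle) : bool :=
  existsb (fun s : nat * nat => let (a, b) := s in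
    snonpos (lo a b k) && snonpos (lo a b (next k)) &&
    (sneg (lo a b k) || sneg (lo a b (next k)) || (a =? next k)%nat && (b =? k)%nat))
    (sides t).

Lemma edges_separated (k : nat) (t : triangle) :
  (k < 14)%nat -> In t triangles -> edge_separated k t = true.
Proof.
  intros Hk Ht.
  assert (H : forallb (fun k => forallb (edge_separated k) triangles) (seq 0 14) = true)
    by (vm_compute; reflexivity).
  rewrite forallb_forall in H; specialize (H k); rewrite in_seq in H.
  specialize (H ltac:(lia)); rewrite forallb_forall in H; auto.
Qed.

Lemma edge_outside (g : motion) (k : nat) (t : triangle) (z u v : C) :
  isometry g -> (k < 14)%nat -> In t triangles ->
  along (pt g k) (pt g (next k)) z u ->
  cross (Cminus (pt g k) (pt g (next k))) v < 0 -> germ_outside g t z u v.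
Proof.
  intros Hg Hk Ht (x & r & -> & -> & Hx & Hr & H0 & H1) Hv.
  pose proof (edges_separated k t Hk Ht) as H; unfold edge_separated in H.
  rewrite existsb_exists in H; destruct H as ([a b] & Hs & H).
  rewrite !andb_true_iff in H; destruct H as [[Hk1 Hk2] Hn].
  apply snonpos_le in Hk1, Hk2; rewrite (lo_val g) in Hk1, Hk2 by easy.
  apply (germ_outside_lex g t (a, b)); [easy|]; unfold side_lexneg, lexneg.
  rewrite orient_on_line, cross_on_line.
  rewrite !orb_true_iff, andb_true_iff, !Nat.eqb_eq in Hn.
  assert (Hcase : orient (pt g a) (pt g b) (pt g k) < 0 \/
    orient (pt g a) (pt g b) (pt g (next k)) < 0 \/ a = next k /\ b = k).
  { destruct Hn as [[Hn|Hn]|Hn]; [left|right; left|tauto]; apply sneg_neg in Hn;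
      rewrite (lo_val g) in Hn by easy; lra. }
  destruct Hcase as [Hc|[Hc|[-> ->]]].
  - destruct (Req_dec x 1) as [->|Hx1]; [|left; nra].
    specialize (H1 eq_refl).
    destruct (Rle_lt_or_eq_dec (orient (pt g a) (pt g b) (pt g (next k))) 0) as [Hd|Hd];
      [lra|left; lra|right; split; [lra|left; nra]].
  - destruct (Req_dec x 0) as [->|Hx0]; [|left; nra].
    specialize (H0 eq_refl).
    destruct (Rle_lt_or_eq_dec (orient (pt g a) (pt g b) (pt g k)) 0) as [Hd|Hd];
      [lra|left; lra|right; split; [lra|left; nra]].
  - rewrite orient_aba, orient_abb; right; split; [ring|right; split; [ring|easy]].
Qed.

(* The turn by 30 n degrees, to the left if s is true and to the right otherwise. *)
Definition turn (s : bool) (n : nat) : nat := if s then n else (12 - n)%nat.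
Definition sgn (s : bool) : R := if s then 1 else -1.

Lemma cross_turn_90 (s : bool) (e : C) :
  cross e (Cmult (Cpow zeta (turn s 3)) e) = sgn s * (Re e * Re e + Im e * Im e).
Proof.
  destruct s; cbn [turn Nat.sub].
  - rewrite zeta_3; unfold cross, sgn, Re, Im; simpl; ring.
  - change 9%nat with (6 + 3)%nat; rewrite Cpow_add_r, zeta_6, zeta_3.
    unfold cross, sgn, Re, Im; simpl; ring.
Qed.

Lemma cross_turn_60 (s : bool) (e : C) :
  cross e (Cmult (Cpow zeta (turn s 2)) e) =
  sgn s * (sqrt 3 / 2) * (Re e * Re e + Im e * Im e).
Proof.
  destruct s; cbn [turn Nat.sub].
  - rewrite zeta_2; unfold cross, sgn, Re, Im; simpl; field.
  - change 10%nat with (3 + 3 + 2 + 2)%nat; rewrite !Cpow_add_r, zeta_2, zeta_3.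
    unfold cross, sgn, Re, Im; simpl.
    pose proof sqrt3_sq as H; set (q := sqrt 3) in *; clearbody q; field [H].
Qed.

(* The ends of edge k, ordered so that the exterior of the tile is to the left of the
   edge if s is true and to the right otherwise. *)
Definition start (s : bool) (k : nat) : nat := if s then k else next k.
Definition stop (s : bool) (k : nat) : nat := if s then next k else k.

Lemma edge_unit (g : motion) (s : bool) (k : nat) :
  isometry g -> (k < 14)%nat ->
  let e := Cminus (pt g (stop s k)) (pt g (start s k)) in
  Re e * Re e + Im e * Im e = 1.
Proof.
  intros Hg Hk e.
  assert (H : forallb (fun k => let x := lsub (vertex (stop s k)) (vertex (start s k)) in
    let n := lcross x (lrot 3 x) in szero (fst n - 4, snd n)%Z) (seq 0 14) = true)
    by (destruct s; vm_compute; reflexivity).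
  rewrite forallb_forall in H; specialize (H k); rewrite in_seq in H.
  specialize (H ltac:(lia)); cbv zeta in H.
  set (x := lsub (vertex (stop s k)) (vertex (start s k))) in H.
  pose proof (lcross_val x (lrot 3 x)) as E; rewrite lval_rot in E.
  rewrite (cross_turn_90 true) in E; unfold sgn in E.
  apply szero_zero in H; unfold sval in H, E; cbn [fst snd] in H.
  rewrite minus_IZR in H; unfold e; rewrite pt_minus; fold x.
  apply isometry_sq in Hg; destruct g as [[a b] c]; cbn [fst] in *.
  destruct (lval x) as [x1 x2]; unfold Re, Im in *; cbn [fst snd Cmult] in *.
  transitivity ((a * a + b * b) * (x1 * x1 + x2 * x2)); [ring|].
  rewrite Hg; lra.
Qed.

(** Parallel unit vectors differ by a sign, and the side on which the tile lies selects it. The case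
    x = 1 drops out because u would point out of the edge. *)
Lemma along_edge (g : motion) (s : bool) (k : nat) (z u : C) :
  isometry g -> (k < 14)%nat -> along (pt g k) (pt g (next k)) z u ->
  Re u * Re u + Im u * Im u = 1 ->
  0 < cross (Cminus (pt g k) (pt g (next k))) (Cmult (Cpow zeta (turn s 3)) u) ->
  u = Cminus (pt g (start s k)) (pt g (stop s k)) /\
  exists x, 0 <= x < 1 /\
    z = Cplus (pt g (stop s k))
          (Cmult (RtoC x) (Cminus (pt g (start s k)) (pt g (stop s k)))).
Proof.
  intros Hg Hk (x & r & -> & -> & Hx & Hr & H0 & H1) Hu Hc.
  pose proof (edge_unit g true k Hg Hk) as He; cbv zeta in He; cbn [start stop] in He.
  set (e := Cminus (pt g (next k)) (pt g k)) in *.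
  replace (cross _ _) with (- r * cross e (Cmult (Cpow zeta (turn s 3)) e)) in Hc
    by (unfold e, cross, Re, Im; simpl; ring).
  rewrite cross_turn_90, He in Hc.
  assert (Hr2 : r * r = 1).
  { replace (_ + _) with (r * r * (Re e * Re e + Im e * Im e)) in Hu
      by (unfold Re, Im; simpl; ring).
    rewrite He in Hu; lra. }
  destruct s; cbn [start stop sgn] in *.
  - assert (r = -1) by nra; subst r; split; [unfold e; C_ext; ring|].
    exists (1 - x); split; [|unfold e; C_ext; ring].
    split; [lra|]; apply Rnot_le_lt; intros Hn.
    specialize (H0 ltac:(lra)); lra.
  - assert (r = 1) by nra; subst r; split; [unfold e; C_ext; ring|].
    exists x; split; [|unfold e; C_ext; ring].
    split; [lra|]; apply Rnot_le_lt; intros Hn.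
    specialize (H1 ltac:(lra)); lra.
Qed.

(** * Angles at vertices and corners *)

Definition lgerm_open (a : nat) (w : lat) (t : triangle) : bool :=
  forallb (fun s : nat * nat => let (i, j) := s in
    spos (lo i j a) ||
    szero (lo i j a) && spos (lcross (lsub (vertex j) (vertex i)) w)) (sides t).

Lemma lgerm_open_germ (g : motion) (a : nat) (w : lat) (t : triangle) :
  isometry g -> lgerm_open a w t = true ->
  germ_open g t (pt g a) (Cmult (fst g) (lval w)) 0.
Proof.
  intros Hg H; unfold lgerm_open in H; rewrite forallb_forall in H.
  apply germ_open_lex; intros [i j] Hs; specialize (H _ Hs); cbv beta iota in H.
  unfold side_lexpos, lexpos; rewrite pt_minus, cross_isometry by easy.
  rewrite orb_true_iff, andb_true_iff in H; destruct H as [H|[H1 H2]].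
  - apply spos_pos in H; rewrite (lo_val g) in H by easy; left; lra.
  - apply szero_zero in H1; apply spos_pos in H2.
    rewrite (lo_val g) in H1 by easy; rewrite lcross_val in H2.
    right; split; [lra|left; lra].
Qed.

(* The direction at 75 degrees from the direction x; the angles of the Spectre are at
   least 90 degrees. *)
Definition lsector (s : bool) (x : lat) : lat :=
  ladd (lrot (turn s 2) x) (lrot (turn s 3) x).
Definition sector (s : bool) (u : C) : C :=
  Cmult (Cplus (Cpow zeta (turn s 2)) (Cpow zeta (turn s 3))) u.

Lemma lsector_val (g : motion) (s : bool) (a b : nat) :
  Cmult (fst g) (lval (lsector s (lsub (vertex a) (vertex b)))) =
  sector s (Cminus (pt g a) (pt g b)).
Proof.
  unfold lsector, sector; rewrite lval_add, !lval_rot, pt_minus; ring.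
Qed.

Lemma vertex_sector (g : motion) (s : bool) (k : nat) :
  isometry g -> (k < 14)%nat -> exists t, In t triangles /\
    germ_open g t (pt g (stop s k))
      (sector s (Cminus (pt g (start s k)) (pt g (stop s k)))) 0.
Proof.
  intros Hg Hk.
  assert (H : forallb (fun k => existsb (lgerm_open (stop s k)
    (lsector s (lsub (vertex (start s k)) (vertex (stop s k))))) triangles)
    (seq 0 14) = true) by (destruct s; vm_compute; reflexivity).
  rewrite forallb_forall in H; specialize (H k); rewrite in_seq in H.
  specialize (H ltac:(lia)); rewrite existsb_exists in H; destruct H as (t & Ht & H).
  exists t; split; [easy|]; rewrite <- lsector_val; now apply lgerm_open_germ.
Qed.

Lemma midpoint_sector (g : motion) (s : bool) (k : nat) (x : R) :
  isometry g -> (k < 14)%nat -> 0 < x < 1 -> exists t, In t triangles /\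
    germ_open g t (Cplus (pt g (stop s k))
        (Cmult (RtoC x) (Cminus (pt g (start s k)) (pt g (stop s k)))))
      (sector s (Cminus (pt g (start s k)) (pt g (stop s k)))) 0.
Proof.
  intros Hg Hk Hx; destruct (edge_triangle_side k Hk) as [Ht Hs].
  exists (edge_triangle k); split; [easy|].
  pose proof (edge_unit g s k Hg Hk) as He; cbv zeta in He.
  assert (Hw : forall e, sector s e = Cplus (Cmult (Cpow zeta (turn s 2)) e)
    (Cmult (Cpow zeta (turn s 3)) e)) by (intros e; unfold sector; ring).
  assert (Hc : forall e, Re e * Re e + Im e * Im e = 1 ->
    cross e (sector s e) = sgn s * (sqrt 3 / 2 + 1)).
  { intros e E; rewrite Hw.
    transitivity (cross e (Cmult (Cpow zeta (turn s 2)) e)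
      + cross e (Cmult (Cpow zeta (turn s 3)) e));
      [unfold cross, Re, Im; simpl; ring|].
    rewrite cross_turn_60, cross_turn_90, E; ring. }
  pose proof sqrt3_pos.
  set (e := Cminus (pt g (start s k)) (pt g (stop s k))) in *.
  assert (He' : Re e * Re e + Im e * Im e = 1).
  { rewrite <- He; unfold e, Re, Im; simpl; ring. }
  specialize (Hc e He'); destruct s; cbn [start stop sgn] in *.
  - apply germ_open_midpoint; try easy; fold e; lra.
  - replace (Cplus _ _) with (Cplus (pt g (next k)) (Cmult (RtoC (1 - x))
      (Cminus (pt g k) (pt g (next k))))) by (unfold e; C_ext; ring).
    apply germ_open_midpoint; try easy; [lra|].
    replace (cross _ _) with (- cross e (sector false e)); [lra|].
    generalize (sector false e); intros w; unfold e, cross, Re, Im; simpl; ring.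
Qed.

Definition lgerm_outside (a : nat) (u : lat) (t : triangle) : bool :=
  existsb (fun s : nat * nat => let (i, j) := s in
    sneg (lo i j a) ||
    szero (lo i j a) && sneg (lcross (lsub (vertex j) (vertex i)) u)) (sides t).

Lemma lgerm_outside_germ (g : motion) (a : nat) (u : lat) (t : triangle) (v : C) :
  isometry g -> lgerm_outside a u t = true ->
  germ_outside g t (pt g a) (Cmult (fst g) (lval u)) v.
Proof.
  intros Hg H; unfold lgerm_outside in H; rewrite existsb_exists in H.
  destruct H as ([i j] & Hs & H).
  apply (germ_outside_lex g t (i, j)); [easy|].
  unfold side_lexneg, lexneg; rewrite pt_minus, cross_isometry by easy.
  rewrite orb_true_iff, andb_true_iff in H; destruct H as [H|[H1 H2]].
  - apply sneg_neg in H; rewrite (lo_val g) in H by easy; left; lra.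
  - apply szero_zero in H1; apply sneg_neg in H2.
    rewrite (lo_val g) in H1 by easy; rewrite lcross_val in H2.
    right; split; [lra|left; lra].
Qed.

(* The edges at P_3 and P_7, with the side on which the exterior lies when the edge is
   traversed from that vertex. *)
Definition corner_edges : list (nat * bool) :=
  [(2, false); (3, true); (6, false); (7, true)]%nat.

(** The corner is convex, so the edge continued backwards beyond it leaves the tile at once,
    whatever the second-order term. *)
Lemma corner_outside (g : motion) (s : bool) (k : nat) (t : triangle) (v : C) :
  isometry g -> In (k, s) corner_edges -> In t triangles ->
  germ_outside g t (pt g (start s k)) (Cminus (pt g (start s k)) (pt g (stop s k))) v.
Proof.
  intros Hg Hk Ht; rewrite pt_minus; apply lgerm_outside_germ; [easy|].
  assert (H : forallb (fun ks : nat * bool => let (k, s) := ks in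
    forallb (lgerm_outside (start s k) (lsub (vertex (start s k)) (vertex (stop s k))))
      triangles) corner_edges = true) by (vm_compute; reflexivity).
  rewrite forallb_forall in H; specialize (H _ Hk); cbv beta iota in H.
  rewrite forallb_forall in H; auto.
Qed.

(** Between the continued edge and the other edge at the corner there are 60 degrees, so the
    direction at 75 degrees already points into g. *)
Lemma corner_sector (g : motion) (s : bool) (k : nat) :
  isometry g -> In (k, s) corner_edges -> exists t, In t triangles /\
    germ_open g t (pt g (start s k))
      (sector s (Cminus (pt g (start s k)) (pt g (stop s k)))) 0.
Proof.
  intros Hg Hk.
  assert (H : forallb (fun ks : nat * bool => let (k, s) := ks in
    existsb (lgerm_open (start s k)
      (lsector s (lsub (vertex (start s k)) (vertex (stop s k))))) triangles)
    corner_edges = true) by (vm_compute; reflexivity).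
  rewrite forallb_forall in H; specialize (H _ Hk); cbv beta iota in H.
  rewrite existsb_exists in H; destruct H as (t & Ht & H).
  exists t; split; [easy|]; rewrite <- lsector_val; now apply lgerm_open_germ.
Qed.

(** For a unit direction the edge found by [next_tile] is known up to its offset x along the ray;
    the offset is what [match_edge] has to show to be zero. *)
Lemma next_edge (T : motion -> Prop) (g : motion) (s : bool) (k : nat) (z u : C) :
  piece_tiling T -> T g -> (k < 14)%nat ->
  along (pt g k) (pt g (next k)) z u -> Re u * Re u + Im u * Im u = 1 ->
  cross (Cminus (pt g k) (pt g (next k))) (Cmult (Cpow zeta (turn s 3)) u) < 0 ->
  exists h t' j x, T h /\ In t' triangles /\
    germ_closed h t' z u (Cmult (Cpow zeta (turn s 3)) u) /\ h <> g /\ (j < 14)%nat /\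
    0 <= x < 1 /\ u = Cminus (pt h (start s j)) (pt h (stop s j)) /\
    z = Cplus (pt h (stop s j))
          (Cmult (RtoC x) (Cminus (pt h (start s j)) (pt h (stop s j)))).
Proof.
  intros HT Hg Hk Ha Hu Hc.
  assert (Hi : isometry g) by now apply (pieces_isometry T HT).
  set (v := Cmult (Cpow zeta (turn s 3)) u) in *.
  destruct (edge_triangle_side k Hk) as [Ht Hs].
  destruct (next_tile T g (edge_triangle k) z u v) as
    (h & t' & j & Hh & Ht' & Hcl & Hne & Hj & Ha' & Hc'); try easy.
  - apply (germ_open_along g _ (next k) k); try easy; [now apply along_sym|].
    replace (cross _ _) with (- cross (Cminus (pt g k) (pt g (next k))) v); [lra|].
    unfold cross, Re, Im; simpl; ring.
  - intros t' Ht'; now apply (edge_outside g k).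
  - unfold v; rewrite cross_turn_90, Hu; destruct s; simpl; lra.
  - destruct (along_edge h s j z u) as (Hu' & x & Hx & Hz); try easy.
    + now apply (pieces_isometry T HT).
    + now exists h, t', j, x.
Qed.

Lemma along_start (g : motion) (s : bool) (k : nat) :
  along (pt g k) (pt g (next k)) (pt g (start s k))
    (Cminus (pt g (stop s k)) (pt g (start s k))).
Proof.
  assert (H : forall a b : C, along a b a (Cminus b a)).
  { intros a b; exists 0, 1; split; [C_ext; ring|]; split; [C_ext; ring|]; lra. }
  destruct s; cbn [start stop]; [apply H | apply along_sym, H].
Qed.

Lemma cross_start (g : motion) (s : bool) (k : nat) (n : nat) :
  let e := Cminus (pt g (stop s k)) (pt g (start s k)) in
  cross (Cminus (pt g k) (pt g (next k))) (Cmult (Cpow zeta n) e) =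
  - sgn s * cross e (Cmult (Cpow zeta n) e).
Proof. intros e; unfold e; destruct s; unfold cross, Re, Im; simpl; ring. Qed.

(* If the tile h across the edge did not have a vertex at the corner z of g, then h
   would leave an angle of 60 degrees at z, which no tile fits. *)
Lemma match_edge (T : motion -> Prop) (g : motion) (s : bool) (k : nat) :
  piece_tiling T -> T g -> In (k, s) corner_edges ->
  exists h j, T h /\ (j < 14)%nat /\
    pt h (next j) = pt g k /\ pt h j = pt g (next k).
Proof.
  intros HT Hg Hks.
  assert (Hk : (k < 14)%nat)
    by (simpl in Hks; repeat destruct Hks as [Hks|Hks]; try easy; injection Hks; lia).
  assert (Hi : forall h, T h -> isometry h) by apply (pieces_isometry T HT).
  set (z := pt g (start s k)); set (u := Cminus (pt g (stop s k)) z).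
  pose proof (edge_unit g s k (Hi g Hg) Hk) as Hu; cbv zeta in Hu; fold z u in Hu.
  assert (Hs2 : sgn s * sgn s = 1) by (destruct s; simpl; ring).
  destruct (next_edge T g s k z u) as
    (h & t & j & x & Hh & _ & _ & _ & Hj & Hx & Huh & Hzh); try easy.
  { apply along_start. }
  { unfold u, z; rewrite cross_start, cross_turn_90; fold z u; rewrite Hu; nra. }
  destruct (Req_dec x 0) as [->|Hx0].
  { exists h, j; split; [easy|split; [easy|]].
    assert (E1 : pt h (stop s j) = z) by (rewrite Hzh; ring).
    assert (E2 : pt h (start s j) = pt g (stop s k)).
    { transitivity (Cplus (pt h (stop s j)) u); [rewrite Huh; ring|].
      rewrite E1; unfold u; ring. }
    unfold z in E1; destruct s; cbn [start stop] in *; auto. }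
  exfalso; rewrite <- Huh in Hzh.
  (* For x > 0 the edge of h runs on past the corner. The tile h' beyond this overshoot would have
     to fit into the remaining 60 degrees, but it contains the direction at 75 degrees, where g
     lies. *)
  destruct (next_edge T h s j z (Copp u)) as
    (h' & t' & j' & x' & Hh' & Ht' & Hcl & Hne & Hj' & Hx' & Huh' & Hzh'); try easy.
  { assert (H : forall a b y, 0 < y < 1 ->
      along a b (Cplus b (Cmult (RtoC y) (Cminus a b))) (Copp (Cminus a b))).
    { intros a b y Hy; exists (1 - y), 1.
      split; [C_ext; ring|]; split; [C_ext; ring|]; lra. }
    rewrite Hzh, Huh; destruct s; cbn [start stop]; [|apply along_sym]; apply H; lra. }
  { rewrite <- Hu; unfold Re, Im; simpl; ring. }
  { rewrite Huh.
    replace (Copp _) with (Cminus (pt h (stop s j)) (pt h (start s j))) by ring.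
    rewrite cross_start, cross_turn_90, (edge_unit h s j (Hi h Hh) Hj); nra. }
  assert (E : Copp u = Cminus (pt g (start s k)) (pt g (stop s k))) by (unfold u, z; ring).
  assert (Hne' : h' <> g).
  { intros ->; rewrite E in Hcl.
    pose proof (corner_outside g s k t' (Cmult (Cpow zeta (turn s 3))
      (Cminus (pt g (start s k)) (pt g (stop s k)))) (Hi g Hg) Hks Ht') as Ho.
    destruct (small_exists _ (small_and _ _ Hcl Ho)) as (r & _ & H1 & H2).
    exact (H2 H1). }
  destruct (corner_sector g s k (Hi g Hg) Hks) as (t1 & Ht1 & O1).
  assert (O2 : exists t2, In t2 triangles /\ germ_open h' t2 z (sector s (Copp u)) 0).
  { destruct (Req_dec x' 0) as [->|Hx'0].
    - replace z with (pt h' (stop s j')) by (rewrite Hzh'; ring).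
      rewrite Huh'; now apply vertex_sector; [apply Hi|].
    - rewrite Hzh', Huh'; apply midpoint_sector; [now apply Hi|easy|lra]. }
  destruct O2 as (t2 & Ht2 & O2); rewrite E in O2.
  destruct (small_exists _ (small_and _ _ O1 O2)) as (r & _ & H1 & H2).
  apply Hne'; eapply (pieces_disjoint T HT h' g t2 t1); eauto.
Qed.

(** * Placements of tiles in the lattice *)

Definition compose (g h : motion) : motion :=
  (Cmult (fst g) (fst h), Cplus (Cmult (fst g) (snd h)) (snd g)).

Lemma act_compose (g h : motion) (z : C) : act (compose g h) z = act g (act h z).
Proof. unfold act, compose; simpl; ring. Qed.

Lemma compose_assoc (g h k : motion) :
  compose g (compose h k) = compose (compose g h) k.
Proof. unfold compose; simpl; f_equal; ring. Qed.

(* [(n, t)] stands for the motion z |-> zeta^n z + t. *)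
Definition lmot : Type := (nat * lat)%type.
Definition mval (m : lmot) : motion := (Cpow zeta (fst m), lval (snd m)).
Definition mone : lmot := (0%nat, lzero).
Definition mmul (m n : lmot) : lmot :=
  (((fst m + fst n) mod 12)%nat, ladd (snd m) (lrot (fst m) (snd n))).
Definition meqb (m n : lmot) : bool := (fst m =? fst n)%nat && leqb (snd m) (snd n).

Lemma meqb_eq (m n : lmot) : meqb m n = true -> m = n.
Proof.
  unfold meqb; rewrite andb_true_iff, Nat.eqb_eq; intros [H1 H2].
  apply leqb_eq in H2; destruct m, n; simpl in *; congruence.
Qed.

Lemma meqb_refl (m : lmot) : meqb m m = true.
Proof. unfold meqb, leqb; rewrite Nat.eqb_refl, !Z.eqb_refl; reflexivity. Qed.

Lemma mval_one (g : motion) : compose g (mval mone) = g.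
Proof.
  destruct g; unfold compose, mval, mone; cbn [fst snd Cpow].
  rewrite lval_zero; f_equal; ring.
Qed.

Lemma mval_mul (m n : lmot) : mval (mmul m n) = compose (mval m) (mval n).
Proof.
  unfold mval, mmul, compose; cbn [fst snd].
  rewrite zeta_mod, Cpow_add_r, lval_add, lval_rot; f_equal; ring.
Qed.

(* The motion carrying c, d to a, b, if the rotation by 30 r degrees carries d - c to
   b - a. *)
Definition carry (r : nat) (a c : lat) : lmot := (r, lsub a (lrot r c)).

(** A motion is determined by the images of two distinct points. This is where an arbitrary real
    motion h becomes a lattice motion relative to g. *)
Lemma carry_unique (g h : motion) (r : nat) (a b c d : lat) :
  lrot r (lsub d c) = lsub b a -> lval (lsub d c) <> 0 ->
  act h (lval c) = act g (lval a) -> act h (lval d) = act g (lval b) ->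
  h = compose g (mval (carry r a c)).
Proof.
  intros Hr Hn Hc Hd.
  assert (E : Cmult (fst h) (lval (lsub d c)) = Cmult (fst g) (lval (lsub b a)))
    by now rewrite !lval_sub, <- !act_minus, Hc, Hd.
  rewrite <- Hr, lval_rot in E.
  assert (E1 : fst h = Cmult (fst g) (Cpow zeta r)).
  { transitivity (Cdiv (Cmult (fst h) (lval (lsub d c))) (lval (lsub d c)));
      [field; exact Hn|]; rewrite E; field; exact Hn. }
  unfold act in Hc; rewrite E1 in Hc.
  unfold compose, mval, carry; cbn [fst snd]; rewrite lval_sub, lval_rot.
  destruct h as [u t]; cbn [fst snd] in *; f_equal; [exact E1|].
  replace t with (Cminus (Cplus (Cmult (Cmult (fst g) (Cpow zeta r)) (lval c)) t)
    (Cmult (Cmult (fst g) (Cpow zeta r)) (lval c))) by ring.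
  rewrite Hc; ring.
Qed.

Definition lnonzero (x : lat) : bool := spos (lcross x (lrot 3 x)).

Lemma lnonzero_neq (x : lat) : lnonzero x = true -> lval x <> 0.
Proof.
  intros H E; apply spos_pos in H; rewrite lcross_val, E in H.
  unfold cross, Re, Im in H; simpl in H; lra.
Qed.

(* The image of the tile whose edge j is glued to the edge k. *)
Definition neighbour (k j : nat) : lmot :=
  carry ((nth k dirs 0 + 18 - nth j dirs 0) mod 12)%nat (vertex k) (vertex (next j)).

Lemma neighbour_exists (T : motion -> Prop) (g : motion) (k : nat) :
  piece_tiling T -> T g -> In k [2; 3; 6; 7]%nat ->
  exists j, (j < 14)%nat /\ T (compose g (mval (neighbour k j))).
Proof.
  intros HT Hg Hk.
  assert (Hs : exists s, In (k, s) corner_edges)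
    by (simpl in Hk |- *; repeat destruct Hk as [<-|Hk]; try easy;
        [exists false|exists true|exists false|exists true]; tauto).
  destruct Hs as (s & Hs).
  destruct (match_edge T g s k HT Hg Hs) as (h & j & Hh & Hj & E1 & E2).
  exists j; split; [easy|].
  (* Here 18 = 6 + 12: glued edges are traversed in opposite directions, which gives the half turn
     6, and 12 keeps the subtraction of naturals exact. *)
  assert (H : forallb (fun k => forallb (fun j =>
    leqb (lrot ((nth k dirs 0 + 18 - nth j dirs 0) mod 12)%nat
           (lsub (vertex j) (vertex (next j)))) (lsub (vertex (next k)) (vertex k)) &&
    lnonzero (lsub (vertex j) (vertex (next j)))) (seq 0 14)) [2; 3; 6; 7]%nat = true)
    by (vm_compute; reflexivity).
  rewrite forallb_forall in H; specialize (H _ Hk).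
  rewrite forallb_forall in H; specialize (H j); rewrite in_seq in H.
  specialize (H ltac:(lia)); rewrite andb_true_iff in H; destruct H as [H1 H2].
  apply leqb_eq in H1; apply lnonzero_neq in H2.
  unfold neighbour; rewrite <- (carry_unique g h _ _ (vertex (next k)) _ (vertex j));
    easy.
Qed.

Definition vertices4 : list lat := Eval vm_compute in map (lscale 4) vertices.
Definition vertex4 (k : nat) : lat := nth k vertices4 lzero.

Lemma vertex4_val (k : nat) : lval (vertex4 k) = Cmult (RtoC 4) (lval (vertex k)).
Proof.
  rewrite <- lval_scale; f_equal; exact (map_nth (lscale 4) vertices lzero k).
Qed.

(* Points are given by lattice vectors to be divided by 4. *)
Definition quarter (q : lat) : C := Cmult (RtoC (1 / 4)) (lval q).

Definition in_spectre (q : lat) : bool :=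
  existsb (fun t => forallb (fun s : nat * nat => let (i, j) := s in
    spos (lorient (vertex4 i) (vertex4 j) q)) (sides t)) triangles.

Lemma in_spectre_open (g : motion) (q : lat) :
  isometry g -> in_spectre q = true ->
  exists t, In t triangles /\ in_open g t (act g (quarter q)).
Proof.
  intros Hg H; unfold in_spectre in H; rewrite existsb_exists in H.
  destruct H as (t & Ht & H); exists t; split; [easy|].
  intros a b Hs; rewrite forallb_forall in H; specialize (H _ Hs); cbv beta iota in H.
  apply spos_pos in H; rewrite lorient_val, !vertex4_val in H.
  unfold pt; rewrite orient_act by easy.
  replace (orient _ _ (lval q)) with
    (16 * orient (lval (vertex a)) (lval (vertex b)) (quarter q)) in H; [lra|].
  unfold orient, quarter, Re, Im; simpl; field.
Qed.

(* Found by a search: every overlap that is needed is witnessed by one of these points. *)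
Definition samples : list lat :=
  [Lat 2 0 (-3) (-5); Lat 8 7 (-2) (-6); Lat 4 6 (-3) 2; Lat 6 3 (-4) (-7);
   Lat 8 8 (-5) (-7)]%Z.

(* The sample point q of m in the coordinates of n. *)
Definition relative (m n : lmot) (q : lat) : lat :=
  lrot (12 - fst n) (lsub (ladd (lrot (fst m) q) (lscale 4 (snd m))) (lscale 4 (snd n))).

Lemma relative_val (m n : lmot) (q : lat) :
  (fst n <= 12)%nat -> act (mval n) (quarter (relative m n q)) = act (mval m) (quarter q).
Proof.
  intros Hn; unfold act, relative, quarter, mval; cbn [fst snd].
  rewrite lval_rot, lval_sub, lval_add, lval_rot, !lval_scale.
  transitivity (Cplus (Cmult (Cmult (RtoC (1 / 4))
    (Cmult (Cpow zeta (fst n)) (Cpow zeta (12 - fst n))))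
    (Cminus (Cplus (Cmult (Cpow zeta (fst m)) (lval q)) (Cmult (RtoC (IZR 4)) (lval (snd m))))
       (Cmult (RtoC (IZR 4)) (lval (snd n))))) (lval (snd n))); [ring|].
  rewrite <- Cpow_add_r, Nat.add_comm, Nat.sub_add, zeta_12 by easy.
  destruct (Cpow zeta (fst m)), (lval q), (lval (snd m)), (lval (snd n)); C_ext; field.
Qed.

Definition distinct (m n : lmot) : bool :=
  lnonzero (lsub (lrot (fst m) lone) (lrot (fst n) lone)) || lnonzero (lsub (snd m) (snd n)).

(** A positive answer exhibits a sample point of one tile in the interior of the other; a negative
    one proves nothing. The bounds by 12 make the subtraction in [relative] exact. *)
Definition conflict (m n : lmot) : bool :=
  (fst m <=? 12)%nat && (fst n <=? 12)%nat &&
  existsb (fun q => in_spectre (relative m n q) || in_spectre (relative n m q)) samples &&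
  distinct m n.

Lemma samples_in_spectre (q : lat) : In q samples -> in_spectre q = true.
Proof.
  assert (H : forallb in_spectre samples = true) by (vm_compute; reflexivity).
  rewrite forallb_forall in H; auto.
Qed.

Lemma distinct_neq (g : motion) (m n : lmot) :
  isometry g -> distinct m n = true -> compose g (mval m) <> compose g (mval n).
Proof.
  intros Hg H E.
  assert (Hn : fst g <> 0).
  { intros E0; unfold isometry in Hg; rewrite E0, Cmod_0 in Hg; lra. }
  assert (Hc : forall x y, Cmult (fst g) x = Cmult (fst g) y -> x = y).
  { intros x y Exy; transitivity (Cdiv (Cmult (fst g) x) (fst g)); [field; easy|].
    rewrite Exy; field; easy. }
  pose proof (f_equal fst E) as E1; pose proof (f_equal snd E) as E2.
  cbn [compose mval fst snd] in E1, E2; apply Hc in E1.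
  unfold distinct in H; rewrite orb_true_iff in H; destruct H as [H|H];
    apply lnonzero_neq in H; apply H; rewrite lval_sub.
  - rewrite !lval_rot, E1; ring.
  - rewrite (Hc (lval (snd m)) (lval (snd n))); [ring|].
    transitivity (Cminus (Cplus (Cmult (fst g) (lval (snd m))) (snd g)) (snd g)); [ring|].
    rewrite E2; ring.
Qed.

Lemma conflict_sound (T : motion -> Prop) (g : motion) (m n : lmot) :
  piece_tiling T -> isometry g -> conflict m n = true ->
  T (compose g (mval m)) -> T (compose g (mval n)) -> False.
Proof.
  intros HT Hg H Hm Hn; unfold conflict in H; rewrite !andb_true_iff, !Nat.leb_le in H.
  destruct H as [[[Hm12 Hn12] H] Hd]; apply (distinct_neq g) in Hd; [|easy].
  apply Hd; rewrite existsb_exists in H; destruct H as (q & Hq & H).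
  apply samples_in_spectre in Hq.
  assert (Hi := pieces_isometry T HT _ Hm); assert (Hj := pieces_isometry T HT _ Hn).
  rewrite orb_true_iff in H; destruct H as [H|H].
  - destruct (in_spectre_open _ _ Hi Hq) as (t & Ht & O).
    destruct (in_spectre_open _ _ Hj H) as (t' & Ht' & O').
    rewrite act_compose, relative_val, <- act_compose in O' by easy.
    now apply (pieces_disjoint T HT _ _ t t' (act (compose g (mval m)) (quarter q))).
  - destruct (in_spectre_open _ _ Hj Hq) as (t & Ht & O).
    destruct (in_spectre_open _ _ Hi H) as (t' & Ht' & O').
    rewrite act_compose, relative_val, <- act_compose in O' by easy.
    now apply (pieces_disjoint T HT _ _ t' t (act (compose g (mval n)) (quarter q))).
Qed.

(** * Possible neighbourhoods of a tile *)

Definition neighbours : list (list lmot) :=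
  Eval vm_compute in
  map (fun k => filter (fun m => negb (conflict mone m)) (map (neighbour k) (seq 0 14)))
    [2; 3; 6; 7]%nat.

Lemma neighbours_complete (T : motion -> Prop) (g : motion) (i : nat) :
  piece_tiling T -> T g -> (i < 4)%nat ->
  exists x, In x (nth i neighbours []) /\ T (compose g (mval x)).
Proof.
  intros HT Hg Hi; set (k := nth i [2; 3; 6; 7]%nat 0%nat).
  assert (Hk : In k [2; 3; 6; 7]%nat) by now apply nth_In.
  destruct (neighbour_exists T g k HT Hg Hk) as (j & Hj & HTj).
  exists (neighbour k j); split; [|easy].
  assert (E : nth i neighbours [] = filter (fun m => negb (conflict mone m))
    (map (neighbour k) (seq 0 14)))
    by (unfold k; do 4 (destruct i as [|i]; [vm_compute; reflexivity|]); lia).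
  rewrite E, filter_In, in_map_iff; split.
  - exists j; rewrite in_seq; split; [easy|lia].
  - apply negb_true_iff, not_true_iff_false; intros Hc.
    apply (conflict_sound T g mone (neighbour k j) HT); [|exact Hc| |exact HTj].
    + now apply (pieces_isometry T HT).
    + now rewrite mval_one.
Qed.

(* The motions from a hex to the hexes of the same parity class that share an edge
   with it without their tiles overlapping. *)
Definition hops : list lmot :=
  [(8, Lat 0 2 3 (-1)); (0, Lat (-2) 1 1 1); (4, Lat 3 1 0 (-2)); (8, Lat 1 3 4 (-3));
   (4, Lat 5 0 (-1) (-3)); (8, Lat 3 2 3 (-4)); (0, Lat 2 (-1) (-1) (-1));
   (4, Lat 6 (-2) (-3) (-2))]%nat%Z.

Definition compatible (m : lmot) (l : list lmot) : list lmot :=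
  filter (fun n => negb (conflict m n)) l.

(* The possible tiles across the edges 2, 3, 6 and 7. *)
Definition configurations : list (list lmot) :=
  flat_map (fun x3 =>
    flat_map (fun x7 =>
      let l6 := compatible x7 (compatible x3 (nth 2 neighbours [])) in
      flat_map (fun x2 => map (fun x6 => [x2; x3; x6; x7]) (compatible x2 l6))
        (compatible x7 (compatible x3 (nth 0 neighbours []))))
      (compatible x3 (nth 3 neighbours [])))
    (nth 1 neighbours []).

Definition hop_type (c : list lmot) : list bool :=
  map (fun a => existsb (meqb a) c) hops.

Definition types : list (list bool) :=
  Eval vm_compute in nodup (list_eq_dec bool_dec) (map hop_type configurations).

Lemma types_complete (c : list lmot) : In c configurations -> In (hop_type c) types.
Proof.
  intros Hc.
  assert (H : forallb (fun c => existsb (fun l =>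
    if list_eq_dec bool_dec (hop_type c) l then true else false) types)
    configurations = true) by (vm_compute; reflexivity).
  rewrite forallb_forall in H; specialize (H _ Hc); rewrite existsb_exists in H.
  destruct H as (l & Hl & E).
  destruct (list_eq_dec bool_dec (hop_type c) l) as [El|]; [rewrite El; exact Hl|discriminate].
Qed.

Lemma compatible_in (T : motion -> Prop) (g : motion) (m n : lmot) (l : list lmot) :
  piece_tiling T -> isometry g -> T (compose g (mval m)) -> T (compose g (mval n)) ->
  In n l -> In n (compatible m l).
Proof.
  intros HT Hg Hm Hn Hl; apply filter_In; split; [exact Hl|].
  apply negb_true_iff, not_true_iff_false; intros Hc.
  exact (conflict_sound T g m n HT Hg Hc Hm Hn).
Qed.

Lemma configuration_exists (T : motion -> Prop) (g : motion) :
  piece_tiling T -> T g ->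
  exists x2 x3 x6 x7, In [x2; x3; x6; x7] configurations /\
    (forall x, In x [x2; x3; x6; x7] -> T (compose g (mval x))) /\
    (forall i, (i < 4)%nat ->
      In (nth i [x2; x3; x6; x7] mone) (nth i neighbours [])).
Proof.
  intros HT Hg; assert (Hi := pieces_isometry T HT g Hg).
  destruct (neighbours_complete T g 0 HT Hg ltac:(lia)) as (x2 & N2 & T2).
  destruct (neighbours_complete T g 1 HT Hg ltac:(lia)) as (x3 & N3 & T3).
  destruct (neighbours_complete T g 2 HT Hg ltac:(lia)) as (x6 & N6 & T6).
  destruct (neighbours_complete T g 3 HT Hg ltac:(lia)) as (x7 & N7 & T7).
  assert (HC : forall m n l, T (compose g (mval m)) -> T (compose g (mval n)) ->
    In n l -> In n (compatible m l))
    by (intros m n l; exact (compatible_in T g m n l HT Hi)).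
  exists x2, x3, x6, x7; split; [|split].
  - unfold configurations; rewrite in_flat_map; exists x3; split; [exact N3|].
    rewrite in_flat_map; exists x7; split; [exact (HC _ _ _ T3 T7 N7)|].
    rewrite in_flat_map; exists x2; split; [exact (HC _ _ _ T7 T2 (HC _ _ _ T3 T2 N2))|].
    rewrite in_map_iff; exists x6; split; [reflexivity|].
    exact (HC _ _ _ T2 T6 (HC _ _ _ T7 T6 (HC _ _ _ T3 T6 N6))).
  - intros x [<-|[<-|[<-|[<-|[]]]]]; assumption.
  - intros i Hi4; do 4 (destruct i as [|i]; [assumption|]); lia.
Qed.

(* The edge, as a position in [neighbours], at which a hop attaches. *)
Definition hop_edge (i : nat) : nat := nth i [0; 0; 1; 1; 2; 2; 3; 3]%nat 0%nat.

(** Turns presence into absence: whichever tile is glued to the edge of a hop, it is that hop or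
    overlaps it. So the four glued tiles decide about all eight hops. *)
Lemma hop_alternatives (i : nat) (x : lmot) :
  (i < 8)%nat -> In x (nth (hop_edge i) neighbours []) ->
  nth i hops mone = x \/ conflict (nth i hops mone) x = true.
Proof.
  intros Hi Hx.
  assert (H : forallb (fun i => forallb (fun x =>
    meqb (nth i hops mone) x || conflict (nth i hops mone) x)
    (nth (hop_edge i) neighbours [])) (seq 0 8) = true) by (vm_compute; reflexivity).
  rewrite forallb_forall in H; specialize (H i); rewrite in_seq in H.
  specialize (H ltac:(lia)); rewrite forallb_forall in H; specialize (H _ Hx).
  rewrite orb_true_iff in H; destruct H as [H|H]; [left; now apply meqb_eq|now right].
Qed.

(** An equivalence, because the hops that are present extend a cluster and the absent ones close
    it. *)
Definition exact_type (T : motion -> Prop) (g : motion) (l : list bool) : Prop :=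
  forall a b, In (a, b) (combine hops l) -> (b = true <-> T (compose g (mval a))).

Lemma in_combine_map {A B : Type} (f : A -> B) (l : list A) (a : A) (b : B) :
  In (a, b) (combine l (map f l)) -> b = f a /\ In a l.
Proof.
  induction l as [|c l IH]; [easy|].
  intros [E|H]; [injection E as <- <-; split; [reflexivity|now left]|].
  destruct (IH H); split; [easy|now right].
Qed.

Lemma type_exists (T : motion -> Prop) (g : motion) :
  piece_tiling T -> T g -> exists l, In l types /\ exact_type T g l.
Proof.
  intros HT Hg; assert (Hi := pieces_isometry T HT g Hg).
  destruct (configuration_exists T g HT Hg) as (x2 & x3 & x6 & x7 & Hc & HTx & HN).
  exists (hop_type [x2; x3; x6; x7]); split; [exact (types_complete _ Hc)|].
  intros a b Hab; unfold hop_type in Hab.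
  destruct (in_combine_map _ _ _ _ Hab) as [-> Ha]; clear Hab; rewrite existsb_exists; split.
  - intros (x & Hx & E); rewrite (meqb_eq _ _ E); exact (HTx x Hx).
  - intros HTa; apply (In_nth _ _ mone) in Ha; destruct Ha as (i & Hi8 & <-).
    assert (He : (hop_edge i < 4)%nat)
      by (do 8 (destruct i as [|i]; [unfold hop_edge; simpl; lia|]); simpl in Hi8; lia).
    exists (nth (hop_edge i) [x2; x3; x6; x7] mone).
    assert (Hx : In (nth (hop_edge i) [x2; x3; x6; x7] mone) [x2; x3; x6; x7])
      by (apply nth_In; exact He).
    split; [exact Hx|].
    destruct (hop_alternatives i _ Hi8 (HN _ He)) as [E|E]; [rewrite E; apply meqb_refl|].
    exfalso; exact (conflict_sound T g _ _ HT Hi E HTa (HTx _ Hx)).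
Qed.

(** * Hexes that share an edge *)

Definition hex_corners : list lat :=
  [vertex 1; vertex 3; vertex 5; vertex 7; vertex 9;
   ladd lone (ladd (lrot 10 lone) (lrot 7 lone))].
Definition hex_corner (i : nat) : lat := nth (i mod 6) hex_corners lzero.

Lemma p_val : lval (ladd lone (ladd (lrot 10 lone) (lrot 7 lone))) = p.
Proof.
  change (ladd lone (ladd (lrot 10 lone) (lrot 7 lone))) with (Lat 2 (-1) (-1) 0).
  unfold lval, p; C_ext; field.
Qed.

Lemma hex_vertices_val (g : motion) :
  hex_vertices g = map (fun i => act g (lval (hex_corner i))) (seq 0 6).
Proof.
  unfold hex_vertices; cbn [seq map]; unfold hex_corner.
  change (6 mod 6)%nat with 0%nat.
  cbn [Nat.modulo Nat.divmod fst snd Nat.sub nth hex_corners].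
  rewrite <- p_val, <- !vertex_val by lia; reflexivity.
Qed.

Lemma hex_edges (g : motion) (a b : C) :
  In (a, b) (edges (hex_vertices g)) <->
  exists i, (i < 6)%nat /\ a = act g (lval (hex_corner i)) /\
    b = act g (lval (hex_corner (S i))).
Proof.
  rewrite hex_vertices_val; cbv [edges seq map tl firstn app combine].
  split.
  - intros H; repeat destruct H as [E|H]; try easy; injection E as <- <-;
      [exists 0%nat|exists 1%nat|exists 2%nat|exists 3%nat|exists 4%nat|exists 5%nat];
      (split; [lia|split; reflexivity]).
  - intros (i & Hi & -> & ->).
    do 6 (destruct i as [|i]; [simpl; tauto|]); lia.
Qed.

(* The motion that glues the edge j of a hex to the edge i, reversed if [o]. *)
Definition glue (i j : nat) (o : bool) : lmot :=
  carry ((2 * (j + 6 - i) + (if o then 6 else 0)) mod 12)%nat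
    (hex_corner i) (hex_corner (if o then S j else j)).

Lemma share_edge_glue (g h : motion) :
  share_edge g h -> exists i j o, (i < 6)%nat /\ (j < 6)%nat /\
    h = compose g (mval (glue i j o)).
Proof.
  intros (a & b & Hg & Hh).
  (* The corners of a hex run clockwise, so edge j is carried to edge i by a rotation through 60 (j
     - i) degrees, plus a half turn if the edge is reversed. *)
  assert (HC : forall i j o, (i < 6)%nat -> (j < 6)%nat ->
    let c := hex_corner (if o : bool then S j else j) in
    let d := hex_corner (if o : bool then j else S j) in
    lrot ((2 * (j + 6 - i) + (if o then 6 else 0)) mod 12)%nat (lsub d c) =
      lsub (hex_corner (S i)) (hex_corner i) /\ lval (lsub d c) <> 0).
  { intros i j o Hi Hj c d.
    assert (H : forallb (fun o : bool => forallb (fun i => forallb (fun j =>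
      let c := hex_corner (if o : bool then S j else j) in
      let d := hex_corner (if o : bool then j else S j) in
      leqb (lrot ((2 * (j + 6 - i) + (if o then 6 else 0)) mod 12)%nat (lsub d c))
        (lsub (hex_corner (S i)) (hex_corner i)) && lnonzero (lsub d c))
      (seq 0 6)) (seq 0 6)) [true; false] = true) by (vm_compute; reflexivity).
    rewrite forallb_forall in H; specialize (H o).
    specialize (H ltac:(destruct o; simpl; tauto)).
    rewrite forallb_forall in H; specialize (H i); rewrite in_seq in H.
    specialize (H ltac:(lia)); rewrite forallb_forall in H; specialize (H j).
    rewrite in_seq in H; specialize (H ltac:(lia)); cbv zeta in H; fold c d in H.
    rewrite andb_true_iff in H; destruct H as [H1 H2].
    split; [exact (leqb_eq _ _ H1) | exact (lnonzero_neq _ H2)]. }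
  apply hex_edges in Hg; destruct Hg as (i & Hi & Ea & Eb).
  destruct Hh as [Hh|Hh]; apply hex_edges in Hh; destruct Hh as (j & Hj & Ea' & Eb').
  - destruct (HC i j false Hi Hj) as [H1 H2].
    exists i, j, false; split; [easy|split; [easy|]].
    apply (carry_unique _ _ _ _ (hex_corner (S i)) _ (hex_corner (S j)) H1 H2); congruence.
  - destruct (HC i j true Hi Hj) as [H1 H2].
    exists i, j, true; split; [easy|split; [easy|]].
    apply (carry_unique _ _ _ _ (hex_corner (S i)) _ (hex_corner j) H1 H2); congruence.
Qed.

(* In the last two cases the shared edge is dented in both tiles, and the tile in the
   dent of the first one overlaps the second one. *)
Lemma glue_cases (i j : nat) (o : bool) :
  (i < 6)%nat -> (j < 6)%nat ->
  glue i j o = mone \/ conflict mone (glue i j o) = true \/ In (glue i j o) hops \/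
  (forall x, In x (nth 1 neighbours []) -> conflict (glue i j o) x = true) \/
  (forall x, In x (nth 3 neighbours []) -> conflict (glue i j o) x = true).
Proof.
  intros Hi Hj.
  assert (H : forallb (fun o : bool => forallb (fun i => forallb (fun j =>
    let m := glue i j o in
    meqb m mone || (existsb (meqb m) hops || (conflict mone m ||
    (forallb (conflict m) (nth 1 neighbours []) ||
    forallb (conflict m) (nth 3 neighbours [])))))
    (seq 0 6)) (seq 0 6)) [true; false] = true) by (vm_compute; reflexivity).
  rewrite forallb_forall in H; specialize (H o).
  specialize (H ltac:(destruct o; simpl; tauto)).
  rewrite forallb_forall in H; specialize (H i); rewrite in_seq in H.
  specialize (H ltac:(lia)); rewrite forallb_forall in H; specialize (H j).
  rewrite in_seq in H; specialize (H ltac:(lia)); cbv zeta in H.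
  rewrite !orb_true_iff, existsb_exists, !forallb_forall in H.
  destruct H as [H|[(x & Hx & H)|[H|[H|H]]]]; auto.
  - left; exact (meqb_eq _ _ H).
  - apply meqb_eq in H; rewrite H; auto.
Qed.

Lemma share_edge_hop (T : motion -> Prop) (g h : motion) :
  piece_tiling T -> T g -> T h -> share_edge g h ->
  h = g \/ exists a, In a hops /\ h = compose g (mval a).
Proof.
  intros HT Hg Hh Hs; assert (Hi := pieces_isometry T HT g Hg).
  destruct (share_edge_glue g h Hs) as (i & j & o & Hi6 & Hj6 & E).
  assert (Hno : forall k, (k < 4)%nat ->
    ~ forall x, In x (nth k neighbours []) -> conflict (glue i j o) x = true).
  { intros k Hk H; destruct (neighbours_complete T g k HT Hg Hk) as (x & Hx & HTx).
    apply (conflict_sound T g (glue i j o) x HT Hi (H x Hx)); [now rewrite <- E|exact HTx]. }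
  destruct (glue_cases i j o Hi6 Hj6) as [H|[H|[H|[H|H]]]].
  - left; now rewrite E, H, mval_one.
  - exfalso; apply (conflict_sound T g mone (glue i j o) HT Hi H);
      [now rewrite mval_one|now rewrite <- E].
  - right; now exists (glue i j o).
  - exfalso; apply (Hno 1%nat); [lia|exact H].
  - exfalso; apply (Hno 3%nat); [lia|exact H].
Qed.

Lemma hop_share_edge (g : motion) (a : lmot) :
  In a hops -> share_edge g (compose g (mval a)).
Proof.
  intros Ha.
  assert (H : forallb (fun a => existsb (fun i => existsb (fun j =>
    leqb (hex_corner i) (ladd (lrot (fst a) (hex_corner (S j))) (snd a)) &&
    leqb (hex_corner (S i)) (ladd (lrot (fst a) (hex_corner j)) (snd a)))
    (seq 0 6)) (seq 0 6)) hops = true) by (vm_compute; reflexivity).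
  rewrite forallb_forall in H; specialize (H a Ha); rewrite existsb_exists in H.
  destruct H as (i & Hi & H); rewrite existsb_exists in H; destruct H as (j & Hj & H).
  rewrite in_seq in Hi, Hj; rewrite andb_true_iff in H; destruct H as [H1 H2].
  apply leqb_eq in H1, H2.
  assert (E : forall x, act (compose g (mval a)) (lval x) =
    act g (lval (ladd (lrot (fst a) x) (snd a)))).
  { intros x; rewrite act_compose, lval_add, lval_rot; reflexivity. }
  exists (act g (lval (hex_corner i))), (act g (lval (hex_corner (S i)))); split.
  - apply hex_edges; exists i; split; [lia|easy].
  - right; apply hex_edges; exists j; split; [lia|].
    rewrite !E, <- H1, <- H2; easy.
Qed.

Definition member (m : lmot) (l : list lmot) : bool := existsb (meqb m) l.

Lemma member_in (m : lmot) (l : list lmot) : member m l = true <-> In m l.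
Proof.
  unfold member; rewrite existsb_exists; split.
  - intros (x & Hx & E); now rewrite (meqb_eq _ _ E).
  - intros H; exists m; split; [easy|apply meqb_refl].
Qed.

(** * Clusters *)

(* A partial cluster: tiles together with their possible neighbours in the cluster and
   whether these are tiles. *)
Definition cluster : Type := list (lmot * list (lmot * bool)).

Definition missing (st : cluster) : list lmot :=
  flat_map (fun e => flat_map (fun nb : lmot * bool =>
    if snd nb && negb (member (fst nb) (map fst st)) then [fst nb] else []) (snd e)) st.

(** Prunes the search: a tile recorded as absent by one entry cannot be added on account of
    another. *)
Definition consistent (st : cluster) (n : lmot) : bool :=
  forallb (fun e => forallb (fun nb : lmot * bool => negb (meqb (fst nb) n) || snd nb)
    (snd e)) st.

(* Out of fuel gives the empty cluster, which is no triangle. *)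
Fixpoint clusters (fuel : nat) (st : cluster) : list (list lmot) :=
  match missing st with
  | [] => [map fst st]
  | n :: _ =>
    match fuel with
    | O => [[]]
    | S fuel =>
      if consistent st n then
        let around := map (mmul n) hops in
        let present := map (fun m => member m (map fst st)) around in
        flat_map (fun l =>
          if forallb (fun bb : bool * bool => implb (fst bb) (snd bb)) (combine present l)
          then clusters fuel (st ++ [(n, combine around l)]) else []) types
      else []
    end
  end.

(** That 12 additions suffice is confirmed by the final computation, since a branch that ran out of
    fuel would contribute the empty list and fail the test for triangles. *)
Definition all_clusters : list (list lmot) :=
  flat_map (fun l => clusters 12 [(mone, combine (map (mmul mone) hops) l)]) types.

Definition connected (T : motion -> Prop) (g0 : motion) : motion -> motion -> Prop :=
  clos_refl_sym_trans motion (adjacent T g0).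

(** All hops rotate by an even multiple of 30 degrees. *)
Lemma hop_parity (g0 g : motion) (a : lmot) :
  In a hops -> same_parity g0 g -> same_parity g0 (compose g (mval a)).
Proof.
  intros Ha (k & Hk).
  assert (Hc : exists c, fst a = (2 * c)%nat).
  { simpl in Ha; repeat destruct Ha as [<-|Ha]; try easy; cbn [fst];
      [exists 4%nat|exists 0%nat|exists 2%nat|exists 4%nat|exists 2%nat|exists 4%nat|
       exists 0%nat|exists 2%nat]; reflexivity. }
  destruct Hc as (c & Hc); exists (k + Z.of_nat c)%Z.
  cbn [compose mval fst]; rewrite Hk, Hc, <- cis_zeta, mult_INR, plus_IZR, <- INR_IZR_INZ.
  replace (60 * (IZR k + INR c)) with (60 * IZR k + 30 * (INR 2 * INR c)) by (simpl; ring).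
  rewrite cis_add; ring.
Qed.

Section Cluster.

Context (T : motion -> Prop) (g0 g : motion) (HT : piece_tiling T).

Definition reached (m : lmot) : Prop :=
  even_tile T g0 (compose g (mval m)) /\ connected T g0 g (compose g (mval m)).

Definition is_tile (m : lmot) : Prop := T (compose g (mval m)).

Definition valid (st : cluster) : Prop := forall e, In e st ->
  reached (fst e) /\
  (forall x b, In (x, b) (snd e) ->
    (b = true <-> is_tile x) /\ exists a, In a hops /\ x = mmul (fst e) a) /\
  (forall a, In a hops -> exists b, In (mmul (fst e) a, b) (snd e)).

Definition closed_cluster (L : list lmot) : Prop :=
  (forall m, In m L -> reached m) /\
  (forall m a, In m L -> In a hops -> is_tile (mmul m a) -> In (mmul m a) L).

Lemma reached_hop (m a : lmot) :
  reached m -> In a hops -> is_tile (mmul m a) -> reached (mmul m a).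
Proof.
  unfold reached, is_tile; rewrite mval_mul, compose_assoc.
  intros [[Hm He] Hc] Ha HTa.
  assert (He' : even_tile T g0 (compose (compose g (mval m)) (mval a)))
    by (split; [exact HTa|exact (hop_parity _ _ _ Ha He)]).
  split; [exact He'|].
  apply rst_trans with (compose g (mval m)); [exact Hc|apply rst_step].
  split; [split; assumption|split; [exact He'|exact (hop_share_edge _ _ Ha)]].
Qed.

Lemma missing_in (st : cluster) (n : lmot) :
  In n (missing st) <-> exists e, In e st /\ In (n, true) (snd e) /\ ~ In n (map fst st).
Proof.
  unfold missing; rewrite in_flat_map; split.
  - intros (e & He & H); rewrite in_flat_map in H; destruct H as ([x b] & Hx & H).
    cbn [fst snd] in H; destruct b; [cbn [andb] in H|destruct H].
    destruct (member x (map fst st)) eqn:E; [destruct H|].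
    destruct H as [<-|[]]; exists e; split; [exact He|split; [exact Hx|]].
    rewrite <- member_in, E; discriminate.
  - intros (e & He & Hn & Hni); exists e; split; [exact He|].
    rewrite in_flat_map; exists (n, true); split; [exact Hn|]; cbn [fst snd andb].
    rewrite <- member_in in Hni; destruct (member n (map fst st)); [now elim Hni|now left].
Qed.

Lemma in_combine_map_l {A B D : Type} (f : A -> D) (l : list A) (l' : list B) (x : D) (b : B) :
  In (x, b) (combine (map f l) l') <-> exists a, x = f a /\ In (a, b) (combine l l').
Proof.
  revert l'; induction l as [|c l IH]; intros [|b' l']; simpl;
    try (split; [easy|intros (a & _ & [])]).
  rewrite IH; split.
  - intros [E|(a & E & H)]; [injection E as <- <-; exists c; auto|exists a; auto].
  - intros (a & E & [H|H]); [injection H as <- <-; left; congruence|right; now exists a].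
Qed.

(** [combine] truncates to the shorter list; the length of l ensures that each of the eight hops is
    recorded. *)
Lemma valid_snoc (st : cluster) (n : lmot) (l : list bool) :
  valid st -> reached n -> length l = 8%nat -> exact_type T (compose g (mval n)) l ->
  valid (st ++ [(n, combine (map (mmul n) hops) l)]).
Proof.
  intros HV Hn Hl Ht e He; apply in_app_or in He; destruct He as [He|[<-|[]]].
  - exact (HV e He).
  - cbn [fst snd]; split; [exact Hn|split].
    + intros x b Hx; apply in_combine_map_l in Hx; destruct Hx as (a & -> & Ha).
      split; [|exists a; split; [exact (in_combine_l _ _ _ _ Ha)|reflexivity]].
      unfold is_tile; rewrite mval_mul, compose_assoc; exact (Ht a b Ha).
    + intros a Ha; destruct (In_nth _ _ mone Ha) as (i & Hi & E).
      exists (nth i l false); apply in_combine_map_l; exists a; split; [reflexivity|].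
      rewrite <- E, <- combine_nth by (rewrite Hl; reflexivity).
      apply nth_In; rewrite length_combine, Hl; exact Hi.
Qed.

Lemma types_length (l : list bool) : In l types -> length l = 8%nat.
Proof.
  intros Hl; assert (H : forallb (fun l => length l =? 8)%nat types = true)
    by (vm_compute; reflexivity).
  rewrite forallb_forall in H; apply Nat.eqb_eq; exact (H l Hl).
Qed.

Lemma valid_consistent (st : cluster) (n : lmot) :
  valid st -> is_tile n -> consistent st n = true.
Proof.
  intros HV Hn; unfold consistent; rewrite forallb_forall; intros e He.
  rewrite forallb_forall; intros [x b] Hx; cbn [fst snd].
  destruct (meqb x n) eqn:E; [|reflexivity]; apply meqb_eq in E; subst x; cbn [negb orb].
  destruct (HV e He) as (_ & H & _); now apply (H n b).
Qed.

Lemma valid_present (st : cluster) (n : lmot) (l : list bool) :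
  valid st -> exact_type T (compose g (mval n)) l ->
  forallb (fun bb : bool * bool => implb (fst bb) (snd bb))
    (combine (map (fun m => member m (map fst st)) (map (mmul n) hops)) l) = true.
Proof.
  intros HV Ht; rewrite forallb_forall; intros [b b'] Hb; cbn [fst snd].
  rewrite map_map in Hb; apply in_combine_map_l in Hb; destruct Hb as (a & -> & Ha).
  destruct (member (mmul n a) (map fst st)) eqn:E; [|reflexivity]; cbn [implb].
  apply (Ht a b' Ha); rewrite member_in, in_map_iff in E.
  destruct E as (e & E & He); destruct (HV e He) as ([[H _] _] & _).
  rewrite E, mval_mul, compose_assoc in H; exact H.
Qed.

(** Follows the branch on which every added tile gets its actual type in the tiling; by
    [valid_consistent] and [valid_present] this branch is never pruned. *)
Lemma clusters_sound (fuel : nat) (st : cluster) :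
  valid st -> exists L, In L (clusters fuel st) /\
    (L = [] \/ closed_cluster L /\ forall m, In m (map fst st) -> In m L).
Proof.
  revert st; induction fuel as [|fuel IH]; intros st HV; cbn [clusters];
    destruct (missing st) as [|n ns] eqn:Em.
  (* No neighbour is missing, so the tiles collected so far are closed under hops, whatever fuel is
     left. *)
  1, 3: exists (map fst st); split; [now left|right; split; [split|auto]].
  1, 3: intros m Hm; apply in_map_iff in Hm; destruct Hm as (e & <- & He);
    exact (proj1 (HV e He)).
  1, 2: intros m a Hm Ha HTa; apply in_map_iff in Hm; destruct Hm as (e & <- & He);
    destruct (HV e He) as (_ & H1 & H2); destruct (H2 a Ha) as (b & Hb);
    apply NNPP; intros Hn;
    assert (Hin : In (mmul (fst e) a) (missing st));
    [apply missing_in; exists e; split; [exact He|split; [|exact Hn]];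
     replace true with b; [exact Hb|now apply (H1 _ _ Hb)]
    |rewrite Em in Hin; destruct Hin].
  { exists []; split; [now left|now left]. }
  assert (Hn : exists e, In e st /\ In (n, true) (snd e) /\ ~ In n (map fst st))
    by (apply missing_in; rewrite Em; now left).
  destruct Hn as (e & He & Hne & _); destruct (HV e He) as (Hr & H1 & _).
  destruct (H1 n true Hne) as [HTn (a & Ha & En)].
  assert (Hn : is_tile n) by now apply HTn.
  rewrite (valid_consistent st n HV Hn); cbv zeta.
  destruct (type_exists T (compose g (mval n)) HT Hn) as (l & Hl & Ht).
  assert (Hrn : reached n) by (rewrite En in Hn |- *; now apply reached_hop).
  destruct (IH (st ++ [(n, combine (map (mmul n) hops) l)])) as (L & HL & HLc).
  { apply valid_snoc; [exact HV|exact Hrn|exact (types_length l Hl)|exact Ht]. }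
  exists L; split.
  - rewrite in_flat_map; exists l; split; [exact Hl|].
    rewrite (valid_present st n l HV Ht); exact HL.
  - destruct HLc as [->|[Hc Hs]]; [now left|right; split; [exact Hc|]].
    intros m Hm; apply Hs; rewrite map_app, in_app_iff; now left.
Qed.

Lemma all_clusters_sound :
  even_tile T g0 g -> exists L, In L all_clusters /\
    (L = [] \/ closed_cluster L /\ In mone L).
Proof.
  intros Hg; destruct (type_exists T g HT (proj1 Hg)) as (l & Hl & Ht).
  destruct (clusters_sound 12 ([] ++ [(mone, combine (map (mmul mone) hops) l)]))
    as (L & HL & HLc).
  { apply valid_snoc; [intros e []| |exact (types_length l Hl)|now rewrite mval_one].
    split; rewrite mval_one; [exact Hg|apply rst_refl]. }
  exists L; split.
  - unfold all_clusters; rewrite in_flat_map; exists l; split; [exact Hl|exact HL].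
  - destruct HLc as [H|[Hc Hs]]; [now left|right; split; [exact Hc|apply Hs; now left]].
Qed.

Lemma share_edge_sym (h h' : motion) : share_edge h h' -> share_edge h' h.
Proof. intros (a & b & H & [H'|H']); [exists a, b|exists b, a]; tauto. Qed.

(** Membership in L is invariant under adjacency: by [share_edge_hop] an adjacent tile is equal or a
    hop away, and L is closed under hops to tiles. Backward steps follow since sharing an edge is
    symmetric. *)
Lemma closed_cluster_component (L : list lmot) (h : motion) :
  closed_cluster L -> In mone L ->
  (connected T g0 g h <-> exists m, In m L /\ h = compose g (mval m)).
Proof.
  intros [Hr Hc] H1; split.
  - assert (Hstep : forall h h', T h -> T h' -> share_edge h h' ->
      (exists m, In m L /\ h = compose g (mval m)) ->
      exists m, In m L /\ h' = compose g (mval m)).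
    { intros k k' Hk Hk' Hs (m & Hm & E).
      destruct (share_edge_hop T k k' HT Hk Hk' Hs) as [->|(a & Ha & E')];
        [now exists m|exists (mmul m a)].
      rewrite mval_mul, compose_assoc, <- E; split; [|exact E'].
      apply Hc; [exact Hm|exact Ha|].
      unfold is_tile; rewrite mval_mul, compose_assoc, <- E, <- E'; exact Hk'. }
    assert (Hconn : forall k k', connected T g0 k k' ->
      ((exists m, In m L /\ k = compose g (mval m)) <->
       exists m, In m L /\ k' = compose g (mval m))).
    { intros k k' Hk; induction Hk as [k k' ([Hk _] & [Hk' _] & Hs)|k|k k' _ IH|
        k k' k'' _ IH _ IH']; [|tauto|tauto|tauto].
      split; apply Hstep; try easy; now apply share_edge_sym. }
    intros Hh; apply (Hconn _ _ Hh); exists mone; split; [exact H1|].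
    now rewrite mval_one.
  - intros (m & Hm & ->); exact (proj2 (Hr m Hm)).
Qed.

End Cluster.

(** * Clusters as triangles of a tessellation *)

(* Centres and radii of hexes are given by lattice vectors to be divided by 3. *)
Definition third (x : lat) : C := Cmult (RtoC (1 / 3)) (lval x).
(** Three alternate corners of a regular hexagon sum to three times its centre. *)
Definition hex_center3 : lat := ladd (vertex 1) (ladd (vertex 5) (vertex 9)).
Definition center3 (m : lmot) : lat := ladd (lrot (fst m) hex_center3) (lscale 3 (snd m)).
Definition radius3 (q : nat) : lat := lrot (2 * q) (lsub (lscale 3 (vertex 1)) hex_center3).

Definition tessellation_center3 (c r : lat) (ij : nat * nat) : lat :=
  let s := ladd r (lrot 2 r) in
  ladd c (ladd (lscale (Z.of_nat (fst ij)) s) (lscale (Z.of_nat (snd ij)) (lrot 2 s))).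

Definition triangle_indices (n : nat) : list (nat * nat) :=
  filter (fun ij => fst ij + snd ij <? n)%nat (list_prod (seq 0 n) (seq 0 n)).

Lemma triangle_indices_in (n i j : nat) :
  In (i, j) (triangle_indices n) <-> (i + j < n)%nat.
Proof.
  unfold triangle_indices; rewrite filter_In, in_prod_iff, !in_seq, Nat.ltb_lt.
  cbn [fst snd]; lia.
Qed.

Definition lsubset (l l' : list lat) : bool := forallb (fun x => existsb (leqb x) l') l.

Lemma lsubset_in (l l' : list lat) (x : lat) : lsubset l l' = true -> In x l -> In x l'.
Proof.
  unfold lsubset; rewrite forallb_forall; intros H Hx; specialize (H x Hx).
  rewrite existsb_exists in H; destruct H as (y & Hy & E); now rewrite (leqb_eq _ _ E).
Qed.

(** The search runs over the orientation q of the triangle and the hex m at its corner. Even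
    rotation numbers make the hexes translates of each other, so that comparing centres suffices. *)
Definition is_triangle (n : nat) (L : list lmot) : bool :=
  forallb (fun m => Nat.even (fst m)) L &&
  existsb (fun q => existsb (fun m =>
    let cs := map (tessellation_center3 (center3 m) (radius3 q)) (triangle_indices n) in
    lsubset cs (map center3 L) && lsubset (map center3 L) cs) L) (seq 0 6).

Lemma all_clusters_triangle (L : list lmot) :
  In L all_clusters ->
  is_triangle 1 L = true \/ is_triangle 2 L = true \/ is_triangle 3 L = true.
Proof.
  intros HL.
  assert (H : forallb (fun L => is_triangle 1 L || (is_triangle 2 L || is_triangle 3 L))
    all_clusters = true) by (vm_compute; reflexivity).
  rewrite forallb_forall in H; specialize (H L HL); rewrite !orb_true_iff in H; exact H.
Qed.

(** * Hexes as regular hexagons *)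

Lemma same_set_sym (A B : plane_set) : same_set A B -> same_set B A.
Proof. intros H z; now rewrite (H z). Qed.

Lemma same_set_trans (A B D : plane_set) : same_set A B -> same_set B D -> same_set A D.
Proof. intros H H' z; now rewrite (H z). Qed.

Lemma polygon_rotate (a b c d e f : C) :
  same_set (polygon [a; b; c; d; e; f]) (polygon [b; c; d; e; f; a]).
Proof.
  intros z; unfold polygon; cbv [edges tl firstn app combine map fold_right In].
  assert (E : forall l l' : Prop, forall b b' : bool, (l <-> l') -> b = b' ->
    (l \/ b = true <-> l' \/ b' = true)) by (intros l l' x x' Hl ->; tauto).
  apply E; [|btauto].
  split; intros (s & Hs & Hz); exists s; (split; [|exact Hz]); tauto.
Qed.

(** Needed because the corners of a hex are listed clockwise and those of [regular_hexagon]
    counterclockwise. *)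
Lemma polygon_rev (a b c d e f : C) :
  same_set (polygon [a; b; c; d; e; f]) (polygon [f; e; d; c; b; a]).
Proof.
  intros z; unfold polygon; cbv [edges tl firstn app combine map fold_right In].
  assert (E : forall l l' : Prop, forall b b' : bool, (l <-> l') -> b = b' ->
    (l \/ b = true <-> l' \/ b' = true)) by (intros l l' x x' Hl ->; tauto).
  apply E.
  - split; intros ([x y] & Hs & Hz); exists (y, x); (split; [|now apply on_segment_sym]);
      repeat destruct Hs as [Hs|Hs]; try easy; injection Hs as <- <-; tauto.
  - rewrite (crosses_sym z f e), (crosses_sym z e d), (crosses_sym z d c),
      (crosses_sym z c b), (crosses_sym z b a), (crosses_sym z a f).
    btauto.
Qed.

Lemma polygon_shift (F : nat -> C) (n m : nat) :
  (forall k, F (k + 6)%nat = F k) ->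
  same_set (polygon (map F (seq n 6))) (polygon (map F (seq m 6))).
Proof.
  intros HF.
  assert (H : forall k, same_set (polygon (map F (seq 0 6))) (polygon (map F (seq k 6)))).
  { intros k; induction k as [|k IH]; [intros z; reflexivity|].
    apply (same_set_trans _ _ _ IH); cbn [seq map].
    replace (F (S (S (S (S (S (S k))))))) with (F k)
      by (rewrite <- (HF k); f_equal; lia).
    apply polygon_rotate. }
  exact (same_set_trans _ _ _ (same_set_sym _ _ (H n)) (H m)).
Qed.

(** Both lists of corners are windows of length 6 in one sequence F of period 6. As the rotation of
    m is a multiple of 60 degrees, it only shifts the window, and so does q. *)
Lemma hex_regular (g : motion) (m : lmot) (q : nat) :
  Nat.even (fst m) = true ->
  same_set (hex (compose g (mval m)))
    (regular_hexagon (act g (third (center3 m))) (Cmult (fst g) (third (radius3 q)))).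
Proof.
  intros He; apply Nat.even_spec in He; destruct He as (e & He).
  set (F := fun n => Cplus (act g (third (center3 m)))
    (Cmult (Cmult (fst g) (third (radius3 0))) (Cpow zeta (2 * n)))).
  assert (HF : forall k, F (k + 6)%nat = F k).
  { intros k; unfold F; replace (2 * (k + 6))%nat with (2 * k + 12)%nat by lia.
    rewrite Cpow_add_r, zeta_12; ring. }
  assert (Hhex : hex_vertices (compose g (mval m)) =
    map (fun i => F (e + (6 - i))%nat) (seq 0 6)).
  { rewrite hex_vertices_val; apply map_ext_in; intros i Hi; apply in_seq in Hi.
    assert (H : forallb (fun i => leqb (lscale 3 (hex_corner i))
      (ladd hex_center3 (lrot (2 * (6 - i)) (radius3 0)))) (seq 0 6) = true)
      by (vm_compute; reflexivity).
    rewrite forallb_forall in H; specialize (H i); rewrite in_seq in H.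
    specialize (H ltac:(lia)); apply leqb_eq in H.
    assert (E : lval (hex_corner i) =
      Cmult (RtoC (1 / 3)) (lval (lscale 3 (hex_corner i)))).
    { rewrite lval_scale; destruct (lval (hex_corner i)); C_ext; field. }
    rewrite act_compose, E, H; unfold F, third, act, mval, center3; cbn [fst snd].
    rewrite !lval_add, !lval_rot, lval_scale.
    replace (2 * (e + (6 - i)))%nat with (fst m + 2 * (6 - i))%nat by lia.
    rewrite Cpow_add_r.
    generalize (Cpow zeta (2 * (6 - i))); intros w.
    replace (lval (snd m)) with
      (Cmult (RtoC (1 / 3)) (Cmult (RtoC (IZR 3)) (lval (snd m)))) at 1
      by (destruct (lval (snd m)); C_ext; field).
    ring. }
  assert (Hreg : map (fun k => Cplus (act g (third (center3 m)))
      (Cmult (Cmult (fst g) (third (radius3 q))) (cis (60 * INR k)))) (seq 0 6) =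
    map F (seq q 6)).
  { replace (seq q 6) with (map (fun k => q + k)%nat (seq 0 6))
      by (cbn [seq map]; repeat f_equal; lia).
    rewrite map_map; apply map_ext; intros k; unfold F, third, radius3.
    replace (60 * INR k) with (30 * INR (2 * k)) by (rewrite mult_INR; simpl; ring).
    rewrite cis_zeta, !lval_rot.
    replace (2 * (q + k))%nat with (2 * q + 2 * k)%nat by lia.
    rewrite Cpow_add_r; cbn [Nat.mul Nat.add Cpow]; ring. }
  unfold hex, regular_hexagon; rewrite Hhex, Hreg.
  (* The corners of the hex are F (e + 6), ..., F (e + 1), which is this window read backwards. *)
  apply same_set_trans with (polygon (map F (seq (e + 1) 6))); [|now apply polygon_shift].
  cbn [seq map].
  replace (e + (6 - 0))%nat with (S (S (S (S (S (e + 1)))))) by lia.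
  replace (e + (6 - 1))%nat with (S (S (S (S (e + 1))))) by lia.
  replace (e + (6 - 2))%nat with (S (S (S (e + 1)))) by lia.
  replace (e + (6 - 3))%nat with (S (S (e + 1))) by lia.
  replace (e + (6 - 4))%nat with (S (e + 1)) by lia.
  replace (e + (6 - 5))%nat with (e + 1)%nat by lia.
  apply polygon_rev.
Qed.

Lemma tessellation_center (g : motion) (c r : lat) (i j : nat) :
  tessellation_hexagon (act g (third c)) (Cmult (fst g) (third r)) i j =
  regular_hexagon (act g (third (tessellation_center3 c r (i, j))))
    (Cmult (fst g) (third r)).
Proof.
  unfold tessellation_hexagon; f_equal.
  assert (E : cis 60 = Cpow zeta 2)
    by (rewrite <- cis_zeta; f_equal; simpl; ring).
  rewrite E; unfold act, third, tessellation_center3; cbn [fst snd].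
  rewrite !lval_add, !lval_scale, !lval_rot, !lval_add, !lval_rot, <- !INR_IZR_INZ.
  ring.
Qed.

Lemma is_triangle_T (T : motion -> Prop) (g0 g : motion) (K : plane_set -> Prop)
    (L : list lmot) (n : nat) :
  isometry g -> is_triangle n L = true ->
  (forall h, connected T g0 g h <-> exists m, In m L /\ h = compose g (mval m)) ->
  (forall H, K H <-> exists h, connected T g0 g h /\ same_set H (hex h)) ->
  is_T n K.
Proof.
  intros Hg HL Hconn HK; unfold is_triangle in HL.
  rewrite andb_true_iff, forallb_forall, existsb_exists in HL.
  destruct HL as (Heven & q & _ & HL); rewrite existsb_exists in HL.
  destruct HL as (m0 & _ & HL); cbv zeta in HL; rewrite andb_true_iff in HL.
  destruct HL as [HL1 HL2].
  exists (act g (third (center3 m0))), (Cmult (fst g) (third (radius3 q))); split.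
  - apply Cmult_neq_0.
    + intros E; unfold isometry in Hg; rewrite E, Cmod_0 in Hg; lra.
    + unfold third, radius3; rewrite lval_rot; apply Cmult_neq_0.
      * intros E; apply RtoC_inj in E; lra.
      * apply Cmult_neq_0; [apply zeta_nonzero|apply lnonzero_neq; vm_compute; reflexivity].
  - intros H; rewrite HK; split.
    + intros (h & Hh & HH); apply Hconn in Hh; destruct Hh as (m & Hm & ->).
      pose proof (lsubset_in _ _ _ HL2 (in_map center3 _ _ Hm)) as Hc.
      rewrite in_map_iff in Hc; destruct Hc as ([i j] & Ec & Hij).
      exists i, j; split; [now apply triangle_indices_in|].
      rewrite tessellation_center, Ec.
      exact (same_set_trans _ _ _ HH (hex_regular g m q (Heven m Hm))).
    + intros (i & j & Hij & HH); rewrite <- triangle_indices_in in Hij.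
      pose proof (lsubset_in _ _ _ HL1 (in_map (tessellation_center3 (center3 m0)
        (radius3 q)) _ _ Hij)) as Hc.
      rewrite in_map_iff in Hc; destruct Hc as (m & Ec & Hm).
      exists (compose g (mval m)); split; [apply Hconn; now exists m|].
      rewrite tessellation_center, <- Ec in HH.
      exact (same_set_trans _ _ _ HH (same_set_sym _ _ (hex_regular g m q (Heven m Hm)))).
Qed.

Theorem proposition7 :
  forall (T : motion -> Prop) (g0 : motion) (K : plane_set -> Prop),
    spectre_tiling T -> T g0 -> blue_cluster T g0 K ->
    is_T 1 K \/ is_T 2 K \/ is_T 3 K.
Proof.
  intros T g0 K HT _ (g & Hg & HK); apply spectre_tiling_pieces in HT.
  assert (Hi := pieces_isometry T HT g (proj1 Hg)).
  destruct (all_clusters_sound T g0 g HT Hg) as (L & HL & HLc).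
  pose proof (all_clusters_triangle L HL) as Ht.
  destruct HLc as [->|[Hc H1]]; [destruct Ht as [Ht|[Ht|Ht]]; discriminate Ht|].
  pose proof (fun h => closed_cluster_component T g0 g HT L h Hc H1) as Hconn.
  destruct Ht as [Ht|[Ht|Ht]]; [left|right; left|right; right];
    exact (is_triangle_T T g0 g K L _ Hi Ht Hconn HK).
Qed.
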